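(* Let $Q_{R,d}$ (for every data $R$ and every $d\in\mathbb{Z}$) and $Q_R$ (for every data $R$) be formal Laurent series in $\mathbb{Q}((x))$ such that for every data $R$ and every $d\in\mathbb{Z}$ $$Q_R(x)=\sum_{r\ge1}\sum_{I:\ \ell(I)=r}\ \sum_{(d_1,\dots,d_r)}x^{N_R(I;d_1,\dots,d_r)}\prod_{k=1}^rQ_{R^I_k,d_k}(x),$$ where $I$ runs over partitions of $R$ of length $r$ and $(d_1,\dots,d_r)$ over $\mathbb{Z}^r$ with $\sum_id_i=d$ and $\frac{d_1+\alpha(R^I_1)}{n(R^I_1)}>\dots>\frac{d_r+\alpha(R^I_r)}{n(R^I_r)}$. Then for every $R$ and $d$, $$Q_{R,d}(x)=\sum_{r\ge1}\sum_{I:\ \ell(I)=r}\frac{x^{M'_R(I;d)+M_R(I;(d+\alpha(R))/n(R))}}{(x^{n(R^I_1)+n(R^I_2)}-1)\cdots(x^{n(R^I_{r-1})+n(R^I_r)}-1)}\prod_{k=1}^rQ_{R^I_k}(x).$$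
   Context: Fix a finite set $S$, integers $m_P\ge1$ ($P\in S$) and reals $0\le\alpha^P_1<\dots<\alpha^P_{m_P}<1$. A data $R=(R^P_i)_{P\in S,1\le i\le m_P}$ is a family of non-negative integers with $n(R)=\sum_iR^P_i$ positive and independent of $P$; $\alpha(R)=\sum_P\sum_iR^P_i\alpha^P_i$. A partition of $R$ of length $r=\ell(I)$ is a family of non-negative integers $I=(I^P_{i,k})$, $1\le k\le r$, with $\sum_kI^P_{i,k}=R^P_i$, $\sum_iI^P_{i,k}$ independent of $P$, and for each $k$ some $I^P_{i,k}\ne0$. Let $R^I_k$ and $R^I_{\le k}$ be the data $(R^I_k)^P_i=I^P_{i,k}$, $(R^I_{\le k})^P_i=\sum_{k'\le k}I^P_{i,k'}$. Define $N_R(I;d_1,\dots,d_r)=\sum_{k>l}(d_ln(R^I_k)-d_kn(R^I_l))-\sigma_R(I)$ with $\sigma_R(I)=\sum_{P\in S}\sum_{k>l,\ i>t}I^P_{i,k}I^P_{t,l}$; $M'_R(I;d)=-(n(R)-n(R^I_r))d-\sigma_R(I)+(2n(R)-n(R^I_1)-n(R^I_r))$; $M_R(I;\lambda)=\sum_{k=1}^{r-1}(n(R^I_k)+n(R^I_{k+1}))\,[\,n(R^I_{\le k})\lambda-\alpha(R^I_{\le k})\,]$ for $\lambda\in\mathbb{R}$, where $[y]$ is the largest integer $\le y$. The factors $1/(x^a-1)$ are expanded in $\mathbb{Q}((x))$. *)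

(* Defs.v *)
From HB Require Import structures.
From mathcomp Require Import all_boot all_order all_algebra.
From mathcomp Require Import reals.
Set Implicit Arguments. Unset Strict Implicit. Unset Printing Implicit Defensive.
Import Order.TTheory GRing.Theory Num.Theory.
Local Open Scope ring_scope.

(* Formal Laurent series Q((x)).  A series is its coefficient function  *)
(* lcoef : int -> rat together with a lower bound lval below which all  *)
(* coefficients vanish.  The bound is auxiliary data only: every notion *)
(* below (equality, sums) is stated through the coefficients.           *)
Record lser := LSer {
  lval : int;
  lcoef : int -> rat;
  lcoefP : forall n : int, n < lval -> lcoef n = 0 }.

Lemma lzeroP (n : int) : n < 0 -> (fun _ : int => 0 : rat) n = 0.
Proof. by []. Qed.
Definition lzero : lser := LSer lzeroP.

Definition lmono_coef (N n : int) : rat := (n == N)%:R.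
Lemma lmonoP (N n : int) : n < N -> lmono_coef N n = 0.
Proof. by move=> h; rewrite /lmono_coef lt_eqF. Qed.
Definition lmono (N : int) : lser := LSer (@lmonoP N).

Definition lmul_coef (f g : lser) (n : int) : rat :=
  if lval f + lval g <= n then
    \sum_(i < (absz (n - (lval f + lval g))%R).+1)
       lcoef f (lval f + i%:Z) * lcoef g (n - (lval f + i%:Z))
  else 0.
Lemma lmulP (f g : lser) (n : int) : n < lval f + lval g -> lmul_coef f g n = 0.
Proof. by move=> h; rewrite /lmul_coef ifF // lt_geF. Qed.
Definition lmul (f g : lser) : lser := LSer (@lmulP f g).

Definition lprod (s : seq lser) : lser := foldr lmul (lmono 0) s.

(* For a >= 1: the expansion in Q((x)) of 1/(x^a - 1) = -(1 + x^a + x^2a + ...) *)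
Definition linv_xa_m1_coef (a : nat) (n : int) : rat :=
  if (0 <= n) && (a%:Z %| n)%Z then -1 else 0.
Lemma linv_xa_m1P (a : nat) (n : int) : n < 0 -> linv_xa_m1_coef a n = 0.
Proof. by move=> h; rewrite /linv_xa_m1_coef lt_geF. Qed.
Definition linv_xa_m1 (a : nat) : lser := LSer (@linv_xa_m1P a).


(* Summation in the x-adic topology of Q((x)) of a family indexed by an
   eqType J.  [lsummable F]: for every N only finitely many members have a
   nonzero coefficient in degree < N (i.e. valuation < N); this is exactly
   convergence (to 0) of the terms, hence summability, in Q((x)). *)
Definition lsummable (J : eqType) (F : J -> lser) : Prop :=
  forall N : int, exists s : seq J,
    forall j, (exists2 n : int, n < N & lcoef (F j) n != 0) -> j \in s.

Definition lhas_sum (J : eqType) (F : J -> lser) (g : lser) : Prop :=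
  lsummable F /\
  forall n : int, exists s : seq J,
    [/\ uniq s, (forall j, lcoef (F j) n != 0 -> j \in s) &
        lcoef g n = \sum_(j <- s) lcoef (F j) n].

(* Data and partitions.  S : finType (nonempty, with a chosen P0 : S),  *)
(* m : S -> nat, alpha P i (0-based index i < m P) real weights.        *)
(* A data R is represented by R P = [:: R^P_1; ...; R^P_{m_P}].         *)
Section Data.
Variables (S : finType) (m : S -> nat) (rR : realType) (alpha : S -> nat -> rR)
          (P0 : S).

Definition dataT := {ffun S -> seq nat}.
Definition data0 : dataT := [ffun=> [::]].

(* n(R) (computed at P0; independent of P for genuine data) *)
Definition nd (X : dataT) : nat := sumn (X P0).

Definition is_data (X : dataT) : bool :=
  [forall P, size (X P) == m P] && [forall P, sumn (X P) == nd X] && (0 < nd X)%N.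

Definition alphad (X : dataT) : rR :=
  \sum_(P : S) \sum_(i < size (X P)) (nth 0%N (X P) i)%:R * alpha P i.

(* the k-th part R^I_{k+1} (0-based k) of a partition given as the list
   of its parts [:: R^I_1; ...; R^I_r] *)
Definition part (ps : seq dataT) (k : nat) : dataT := nth data0 ps k.

(* ps = [:: R^I_1; ...; R^I_r] is a partition of X of length r = size ps:
   r >= 1, each part has all its entries non-negative integers with P-independent
   sum which is positive (equivalently, since S is nonempty: some entry is
   nonzero), and the parts add up to X entrywise. *)
Definition is_partition (X : dataT) (ps : seq dataT) : bool :=
  (ps != [::]) && all is_data ps &&
  [forall P, all (fun i => \sum_(Y <- ps) nth 0%N (Y P) i == nth 0%N (X P) i)
                 (iota 0 (m P))].

Definition sigmaI (ps : seq dataT) : nat :=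
  \sum_(P : S) \sum_(l < size ps) \sum_(k < size ps | (l < k)%N)
    \sum_(i < m P) \sum_(t < m P | (t < i)%N)
      nth 0%N (part ps k P) i * nth 0%N (part ps l P) t.

Definition NRI (ps : seq dataT) (ds : seq int) : int :=
  \sum_(l < size ps) \sum_(k < size ps | (l < k)%N)
     (nth 0 ds l * (nd (part ps k))%:Z - nth 0 ds k * (nd (part ps l))%:Z)
  - (sigmaI ps)%:Z.

Definition MpRI (X : dataT) (ps : seq dataT) (d : int) : int :=
  - ((nd X)%:Z - (nd (part ps (size ps).-1))%:Z) * d - (sigmaI ps)%:Z
  + (2 * (nd X)%:Z - (nd (part ps 0))%:Z - (nd (part ps (size ps).-1))%:Z).

Definition nd_le (ps : seq dataT) (k : nat) : nat :=
  \sum_(k' < k.+1) nd (part ps k').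
Definition alpha_le (ps : seq dataT) (k : nat) : rR :=
  \sum_(k' < k.+1) alphad (part ps k').

Definition MRI (ps : seq dataT) (lam : rR) : int :=
  \sum_(k < (size ps).-1)
    (nd (part ps k) + nd (part ps k.+1))%:Z *
      Num.floor ((nd_le ps k)%:R * lam - alpha_le ps k).

Definition slope (p : dataT * int) : rR := (p.2%:~R + alphad p.1) / (nd p.1)%:R.

(* Term of the hypothesis sum, indexed by j = [:: (R^I_1,d_1); ...; (R^I_r,d_r)];
   it is 0 unless (R^I_k)_k is a partition of X, sum d_k = d and the slopes
   strictly decrease. *)
Definition hyp_term (Qd : dataT -> int -> lser) (X : dataT) (d : int)
    (j : seq (dataT * int)) : lser :=
  if is_partition X (map fst j) && (\sum_(p <- j) p.2 == d)
     && sorted (fun u v => v < u) (map slope j)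
  then lmul (lmono (NRI (map fst j) (map snd j)))
            (lprod [seq Qd p.1 p.2 | p <- j])
  else lzero.

Definition conc_term (Q : dataT -> lser) (X : dataT) (d : int)
    (ps : seq dataT) : lser :=
  if is_partition X ps then
    lmul (lmono (MpRI X ps d + MRI ps ((d%:~R + alphad X) / (nd X)%:R)))
      (lmul (lprod [seq linv_xa_m1 (nd (part ps k) + nd (part ps k.+1))
                   | k <- iota 0 (size ps).-1])
            (lprod [seq Q Y | Y <- ps]))
  else lzero.

End Data.

(* Main.v *)
Require Import Defs.
From HB Require Import structures.
From mathcomp Require Import all_boot all_order all_algebra.
From mathcomp Require Import boolp reals.
From mathcomp Require Import zify ring lra.
Set Implicit Arguments. Unset Strict Implicit. Unset Printing Implicit Defensive.
Import Order.TTheory GRing.Theory Num.Theory.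
Local Open Scope ring_scope.

(* Put lambda = (d + alpha(R)) / n(R).  Summation by parts turns N_R(I; d_1, ..., d_r)
   into sum_k (n_k + n_(k+1)) D_k plus a constant, where D_k = d_1 + ... + d_k, so
   the I-th term of the inverted formula is the geometric sum of
   (-1)^(r-1) x^N prod_k Q_(R_k) over the cone of those (d_k) whose proper initial
   segments all have slope > lambda.
   Substituting the recursion for each Q_(R_k) gives a sum over sequences of pairs
   (data, degree) cut into blocks of decreasing slope.  For a fixed sequence each
   potential cut contributes a factor [slopes decrease there] - [the initial segment
   has slope > lambda], because N is additive along blocks.  If the sequence has
   length >= 2 then some factor vanishes: otherwise, starting from a first slope
   <= lambda (resp. > lambda), all later ones would be < lambda (resp. > lambda),
   although the average slope is lambda.  So only Q_(R,d) survives.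
   The rearrangement is legitimate because the orders of the Q_(R,d) are bounded
   below uniformly in d, by induction on n(R): N is bounded below in terms of the
   partition alone when slopes decrease. *)

(** * The ring of formal Laurent series *)

(** The bound is only asserted to exist, as a boolean, so that two series with the same coefficients
    are equal. [lser] carries its bound as data and cannot form a ring under Leibniz equality. *)
Record laurent := Laurent {
  lc : int -> rat;
  lcP : `[< exists v : int, forall n, n < v -> lc n = 0 >] }.
HB.instance Definition _ := [isSub for lc].
HB.instance Definition _ := [Choice of laurent by <:].

Definition vge (N : int) (f : laurent) : Prop := forall n, n < N -> lc f n = 0.

Lemma laurentP (f g : laurent) : lc f =1 lc g -> f = g.
Proof. by move=> e; apply/val_inj/funext. Qed.

Lemma vge_exists (f : laurent) : exists v, vge v f.
Proof. by have /asboolP := lcP f. Qed.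

Lemma vge_le (a b : int) f : a <= b -> vge b f -> vge a f.
Proof. by move=> le_ab fb n na; apply/fb/(lt_le_trans na). Qed.

Lemma vge_exists2 (f g : laurent) : exists v, vge v f /\ vge v g.
Proof.
have [v fv] := vge_exists f; have [w gw] := vge_exists g.
by exists (Num.min v w); split; [apply: vge_le fv | apply: vge_le gw];
  rewrite ge_min lexx ?orbT.
Qed.

Definition of_lser (f : lser) : laurent :=
  Laurent (asboolT (ex_intro _ (lval f) (@lcoefP f))).

Lemma lc_add_subproof (f g : laurent) :
  `[< exists v : int, forall n, n < v -> lc f n + lc g n = 0 >].
Proof.
apply/asboolP; have [v [fv gv]] := vge_exists2 f g.
by exists v => n nv; rewrite fv ?gv ?addr0.
Qed.
Definition ladd f g := Laurent (lc_add_subproof f g).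

Lemma lc_opp_subproof (f : laurent) :
  `[< exists v : int, forall n, n < v -> - lc f n = 0 >].
Proof.
apply/asboolP; have [v fv] := vge_exists f.
by exists v => n nv; rewrite fv ?oppr0.
Qed.
Definition lopp f := Laurent (lc_opp_subproof f).

Fact laddA : associative ladd.
Proof. by move=> f g h; apply: laurentP => n /=; rewrite addrA. Qed.
Fact laddC : commutative ladd.
Proof. by move=> f g; apply: laurentP => n /=; rewrite addrC. Qed.
Fact ladd0 : left_id (of_lser lzero) ladd.
Proof. by move=> f; apply: laurentP => n /=; rewrite add0r. Qed.
Fact laddN : left_inverse (of_lser lzero) lopp ladd.
Proof. by move=> f; apply: laurentP => n /=; rewrite addNr. Qed.
HB.instance Definition _ := GRing.isZmodule.Build laurent laddA laddC ladd0 laddN.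

Lemma lcD f g n : lc (f + g) n = lc f n + lc g n. Proof. by []. Qed.
Lemma lcN f n : lc (- f) n = - lc f n. Proof. by []. Qed.
Lemma lc0 n : lc 0 n = 0. Proof. by []. Qed.

Definition to_lser (f : laurent) : lser := LSer (projT2 (cid (vge_exists f))).

Lemma of_lserK f : of_lser (to_lser f) = f.
Proof. exact: laurentP. Qed.

Definition lmult (f g : laurent) := of_lser (lmul (to_lser f) (to_lser g)).

Lemma sum_window (phi : int -> rat) (v : int) (K a b : nat) :
    (forall k, k < v -> phi k = 0) -> (forall k, v + K%:Z <= k -> phi k = 0) ->
  \sum_(i < a + K + b) phi (v - a%:Z + i%:Z) = \sum_(i < K) phi (v + i%:Z).
Proof.
move=> lo hi; rewrite !big_split_ord /=.
rewrite big1 ?add0r => [|i _]; last by apply: lo; have := ltn_ord i; lia.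
rewrite [X in _ + X]big1 ?addr0 => [|i _]; last by apply: hi; lia.
by apply: eq_bigr => i _; congr phi; lia.
Qed.

(** Both windows contain the support of [phi], so each can be padded with zeros to the interval from
    the smaller start to the larger end. *)
Lemma sum_window_eq (phi : int -> rat) (v v' : int) (K K' : nat) :
    (forall k, k < v -> phi k = 0) -> (forall k, v + K%:Z <= k -> phi k = 0) ->
    (forall k, k < v' -> phi k = 0) -> (forall k, v' + K'%:Z <= k -> phi k = 0) ->
  \sum_(i < K) phi (v + i%:Z) = \sum_(i < K') phi (v' + i%:Z).
Proof.
move=> lo hi lo' hi'; pose u := Num.min v v'.
pose e := Num.max (v + K%:Z) (v' + K'%:Z).
rewrite -(@sum_window phi v K (absz (v - u)%R) (absz (e - (v + K%:Z))%R)) //.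
rewrite -(@sum_window phi v' K' (absz (v' - u)%R) (absz (e - (v' + K'%:Z))%R)) //.
have -> : v - (absz (v - u)%R)%:Z = u by rewrite /u; lia.
have -> : v' - (absz (v' - u)%R)%:Z = u by rewrite /u; lia.
have -> // : (absz (v - u)%R + K + absz (e - (v + K%:Z))%R =
  absz (v' - u)%R + K' + absz (e - (v' + K'%:Z))%R)%N by rewrite /u /e; lia.
Qed.

(** Reduces multiplication to polynomials: after shifting by any lower bounds [v], [w], a
    coefficient of the product is read off from truncations. The ring axioms are then inherited from
    polynomial multiplication. *)
Lemma lmul_coef_poly (f g : lser) (v w : int) (K n : nat) :
    vge v (of_lser f) -> vge w (of_lser g) -> (n < K)%N ->
  lmul_coef f g (v + w + n%:Z) =
  ((\poly_(i < K) lcoef f (v + i%:Z)) * (\poly_(i < K) lcoef g (w + i%:Z)))`_n.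
Proof.
move=> fv gw nK; pose phi k := lcoef f k * lcoef g (v + w + n%:Z - k).
(* The support of the convolution summand lies in a window for every choice of lower bounds. This is
   used both for the stored bounds [lval] and for [v], [w]. *)
have phi0 a b : vge a (of_lser f) -> vge b (of_lser g) ->
    forall k, (k < a) || (v + w + n%:Z - b < k) -> phi k = 0.
  move=> fa gb k /orP[ka|kb]; rewrite /phi; first by rewrite [lcoef f k]fa ?mul0r.
  by rewrite [lcoef g _]gb ?mulr0 //; lia.
have fl : vge (lval f) (of_lser f) by exact: lcoefP.
have gl : vge (lval g) (of_lser g) by exact: lcoefP.
have -> : lmul_coef f g (v + w + n%:Z) = \sum_(i < n.+1) phi (v + i%:Z).
  rewrite /lmul_coef; case: ifP => hn.
    apply: (@sum_window_eq phi) => k hk; [apply: (phi0 _ _ fl gl)|apply: (phi0 _ _ fl gl)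
      |apply: (phi0 _ _ fv gw)|apply: (phi0 _ _ fv gw)]; lia.
  by rewrite big1 // => i _; apply: (phi0 _ _ fl gl); lia.
rewrite coefM; apply: eq_bigr => i _; have := ltn_ord i => ilt.
rewrite !coef_poly ifT 1?ifT /phi; [|lia|lia].
by congr (_ * lcoef g _); lia.
Qed.

Lemma lc_lmultE (f g : laurent) (v w : int) (K n : nat) :
    vge v f -> vge w g -> (n < K)%N ->
  lc (lmult f g) (v + w + n%:Z) =
  ((\poly_(i < K) lc f (v + i%:Z)) * (\poly_(i < K) lc g (w + i%:Z)))`_n.
Proof. by move=> fv gw; apply: lmul_coef_poly; rewrite of_lserK. Qed.

Lemma vge_lmult a b f g : vge a f -> vge b g -> vge (a + b) (lmult f g).
Proof.
move=> fa gb n nab; rewrite /= /lmul_coef; case: ifP => // hn.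
rewrite big1 // => i _.
set k := _ + _; have [ka|ka] := ltP k a; first by rewrite [lcoef _ k](fa k) ?mul0r.
by rewrite [X in _ * X](gb (n - k)) ?mulr0 //; lia.
Qed.

Lemma of_lser_mul f g : of_lser (lmul f g) = lmult (of_lser f) (of_lser g).
Proof.
apply: laurentP => n.
have [v fv] := vge_exists (of_lser f); have [w gw] := vge_exists (of_lser g).
have [nlt|nge] := ltP n (v + w).
  rewrite (vge_lmult fv gw) //= /lmul_coef; case: ifP => // hn.
  rewrite big1 // => i _; set k := _ + _.
  have [ka|ka] := ltP k v; first by rewrite [lcoef _ k](fv k) ?mul0r.
  by rewrite [X in _ * X](gw (n - k)) ?mulr0 //; lia.
have -> : n = v + w + (absz (n - (v + w))%R)%:Z by lia.
by rewrite (lc_lmultE fv gw (ltnSn _)) -lmul_coef_poly.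
Qed.

Lemma laurent_eq_vge (v : int) f g : vge v f -> vge v g ->
  (forall n : nat, lc f (v + n%:Z) = lc g (v + n%:Z)) -> f = g.
Proof.
move=> fv gv e; apply: laurentP => n; have [nlt|nge] := ltP n v.
  by rewrite fv ?gv.
by have -> : n = v + (absz (n - v)%R)%:Z by lia.
Qed.

Lemma poly_lmult (f g : laurent) (v w : int) (n : nat) : vge v f -> vge w g ->
  forall i, (i <= n)%N ->
  (\poly_(i < n.+1) lc (lmult f g) (v + w + i%:Z))`_i =
  ((\poly_(i < n.+1) lc f (v + i%:Z)) * (\poly_(i < n.+1) lc g (w + i%:Z)))`_i.
Proof. by move=> fv gw i ilt; rewrite coef_poly ltnS ilt (@lc_lmultE _ _ _ _ n.+1 _ fv gw). Qed.

Fact lmultC : commutative lmult.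
Proof.
move=> f g; have [v fv] := vge_exists f; have [w gw] := vge_exists g.
apply: (@laurent_eq_vge (v + w)); [exact: vge_lmult | by rewrite addrC; exact: vge_lmult |].
by move=> n; rewrite (lc_lmultE fv gw (ltnSn n)) mulrC -(lc_lmultE gw fv (ltnSn n)) [w + v]addrC.
Qed.

Fact lmultA : associative lmult.
Proof.
move=> f g h; have [u fu] := vge_exists f; have [v gv] := vge_exists g.
have [w hw] := vge_exists h; have fg := vge_lmult fu gv; have gh := vge_lmult gv hw.
apply: (@laurent_eq_vge (u + v + w)); [by rewrite -addrA; exact: vge_lmult
  |exact: vge_lmult|move=> n].
rewrite (lc_lmultE fg hw (ltnSn n)) -(addrA u v w) (lc_lmultE fu gh (ltnSn n)).
set pf := \poly_(i < n.+1) lc f _; set ph := \poly_(i < n.+1) lc h _.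
pose pg := \poly_(i < n.+1) lc g (v + i%:Z).
(* The truncation of a product and the product of truncations agree only up to degree [n], which is
   all that the coefficient of degree [n] sees. *)
transitivity ((pf * (pg * ph))`_n); last rewrite mulrA; rewrite !coefM;
  apply: eq_bigr => i _; congr (_ * _).
  by rewrite poly_lmult // leq_subr.
by rewrite poly_lmult // -ltnS.
Qed.

Fact lmult1 : left_id (of_lser (lmono 0)) lmult.
Proof.
move=> f; have [v fv] := vge_exists f.
have o0 : vge 0 (of_lser (lmono 0)) by exact: lmonoP.
apply: (@laurent_eq_vge (0 + v)) => [||n]; [exact: vge_lmult|by rewrite add0r|].
rewrite (lc_lmultE o0 fv (ltnSn n)) coefM big_ord_recl big1 => [|i _].
  by rewrite !coef_poly /= subn0 ltnSn /lmono_coef !add0r eqxx mul1r addr0.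
by rewrite coef_poly /=; case: ifP; rewrite /lmono_coef ?mul0r // add0r mul0r.
Qed.

Fact lmultDl : left_distributive lmult +%R.
Proof.
move=> f g h; have [v [fv gv]] := vge_exists2 f g; have [w hw] := vge_exists h.
have fgv : vge v (f + g) by move=> n nv /=; rewrite fv ?gv.
apply: (@laurent_eq_vge (v + w)) => [||n]; first exact: vge_lmult.
  by move=> n nv; rewrite lcD (vge_lmult fv hw nv) (vge_lmult gv hw nv).
have pD : \poly_(i < n.+1) lc (f + g) (v + i%:Z) =
    \poly_(i < n.+1) lc f (v + i%:Z) + \poly_(i < n.+1) lc g (v + i%:Z).
  by apply/polyP => i; rewrite coefD !coef_poly; case: ifP; rewrite ?addr0.
rewrite lcD (lc_lmultE fgv hw (ltnSn n)) (lc_lmultE fv hw (ltnSn n)).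
by rewrite (lc_lmultE gv hw (ltnSn n)) -coefD -mulrDl -pD.
Qed.

Fact lone_neq0 : of_lser (lmono 0) != 0.
Proof.
by apply/eqP => /(congr1 (fun f => lc f 0)) /eqP; rewrite /= /lmono_coef eqxx oner_eq0.
Qed.

HB.instance Definition _ := GRing.Zmodule_isComNzRing.Build laurent
  lmultA lmultC lmult1 lmultDl lone_neq0.

(** * Summable families of Laurent series *)

Lemma lc_sum (I : Type) (s : seq I) (F : I -> laurent) n :
  lc (\sum_(i <- s) F i) n = \sum_(i <- s) lc (F i) n.
Proof. exact: (big_morph (fun f => lc f n) (fun f g => lcD f g n) (lc0 n)). Qed.

Lemma vge0 N : vge N 0. Proof. by []. Qed.

Lemma vgeD N f g : vge N f -> vge N g -> vge N (f + g).
Proof. by move=> fN gN n nN; rewrite lcD fN ?gN. Qed.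

Lemma vgeN N f : vge N f -> vge N (- f).
Proof. by move=> fN n nN; rewrite lcN fN ?oppr0. Qed.

Lemma vgeB N f g : vge N f -> vge N g -> vge N (f - g).
Proof. by move=> fN gN; apply/vgeD/vgeN. Qed.

Lemma vgeM a b f g : vge a f -> vge b g -> vge (a + b) (f * g).
Proof. exact: vge_lmult. Qed.

Lemma vge_sum N (I : eqType) (s : seq I) (P : pred I) (F : I -> laurent) :
  (forall i, i \in s -> P i -> vge N (F i)) -> vge N (\sum_(i <- s | P i) F i).
Proof.
by move=> h; rewrite big_seq_cond; elim/big_ind: _ => //;
  [exact: vgeD | move=> i /andP[/h]].
Qed.

Lemma exists_uniform_bound (J : eqType) (s : seq J) (P : J -> int -> Prop) :
    (forall j a b, a <= b -> P j b -> P j a) -> (forall j, j \in s -> exists w, P j w) ->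
  exists w, forall j, j \in s -> P j w.
Proof.
move=> mono; elim: s => [|j s IHs] h; first by exists 0.
have [w1 h1] := h j (mem_head _ _).
have [|w2 h2] := IHs; first by move=> k ks; apply: h; rewrite inE ks orbT.
exists (Num.min w1 w2) => k; rewrite inE => /orP[/eqP->|ks].
  by apply: mono h1; rewrite ge_min lexx.
by apply: mono (h2 _ ks); rewrite ge_min lexx orbT.
Qed.

(* Equivalent to lhas_sum; this form, with one exceptional set per precision, is
   stable under products and regrouping. *)
Definition sums_to (J : eqType) (F : J -> laurent) (g : laurent) : Prop :=
  forall N : int, exists s : seq J,
    [/\ uniq s, forall j, j \notin s -> vge N (F j) & vge N (g - \sum_(j <- s) F j)].

Section Sums.
Variables (J : eqType).
Implicit Types (F G : J -> laurent) (g : laurent) (s : seq J) (N : int).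

Lemma vge_sum_supset N F s t : uniq s -> uniq t -> {subset s <= t} ->
    (forall j, j \notin s -> vge N (F j)) ->
  vge N (\sum_(j <- t) F j - \sum_(j <- s) F j).
Proof.
move=> us ut st h; rewrite (bigID [in s]) /= -big_filter.
have -> : \sum_(j <- [seq j <- t | j \in s]) F j = \sum_(j <- s) F j.
  apply: perm_big; apply: uniq_perm; rewrite ?filter_uniq // => j.
  by rewrite mem_filter; case: (boolP (j \in s)) => //= /st.
by rewrite addrAC subrr add0r; apply: vge_sum => j _ /h.
Qed.

Lemma vge_sum_any N F s t : uniq s -> uniq t ->
    (forall j, j \notin s -> vge N (F j)) -> (forall j, j \notin t -> vge N (F j)) ->
  vge N (\sum_(j <- t) F j - \sum_(j <- s) F j).
Proof.
move=> us ut hs ht; set u := undup (s ++ t).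
have Au : vge N (\sum_(j <- u) F j - \sum_(j <- s) F j).
  by apply: vge_sum_supset; rewrite ?undup_uniq // => j js; rewrite mem_undup mem_cat js.
have Bu : vge N (\sum_(j <- u) F j - \sum_(j <- t) F j).
  by apply: vge_sum_supset; rewrite ?undup_uniq // => j js;
    rewrite mem_undup mem_cat js orbT.
by have := vgeB Au Bu; congr vge; ring.
Qed.

(** The exceptional set provided by [sums_to] may be exchanged for any finite set outside which the
    terms are small: both are compared with their union. *)
Lemma sums_to_any F g s N : sums_to F g -> uniq s -> (forall j, j \notin s -> vge N (F j)) ->
  vge N (g - \sum_(j <- s) F j).
Proof.
move=> /(_ N)[t [ut ht gt]] us hs; have := vgeD gt (vge_sum_any us ut hs ht).
by congr vge; ring.
Qed.

Lemma sums_to_vge F g N : sums_to F g -> (forall j, vge N (F j)) -> vge N g.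
Proof.
by move=> hF h; have := @sums_to_any F g [::] N hF isT; rewrite big_nil subr0; apply.
Qed.

Lemma sums_to_ext F G g : F =1 G -> sums_to F g -> sums_to G g.
Proof. by move=> /funext->. Qed.

Lemma sums_to_bound F g : sums_to F g -> exists N, forall j, vge N (F j).
Proof.
move=> /(_ 0)[s [us hs _]].
have [//||w hw] := @exists_uniform_bound J s (fun j w => vge w (F j)).
- by move=> j a b; exact: vge_le.
- by move=> j _; exact: vge_exists.
exists (Num.min w 0) => j; have [js|js] := boolP (j \in s).
  by apply: vge_le (hw _ js); rewrite ge_min lexx.
by apply: vge_le (hs _ js); rewrite ge_min lexx orbT.
Qed.

Lemma sums_to_finite F s : uniq s -> (forall j, j \notin s -> F j = 0) ->
  sums_to F (\sum_(j <- s) F j).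
Proof.
by move=> us h N; exists s; split => // [j /h->|]; rewrite ?subrr; exact: vge0.
Qed.

Lemma sums_to_scale F g c : sums_to F g -> sums_to (fun j => F j * c) (g * c).
Proof.
move=> h N; have [v cv] := vge_exists c; have [s [us hs gs]] := h (N - v).
exists s; split => // [j /hs js|].
  by rewrite -[N](subrK v); exact: vgeM.
by rewrite -mulr_suml -mulrBl -[N](subrK v); exact: vgeM.
Qed.

End Sums.

(** A convergent family has a uniform lower bound on its orders. With bounds [a] for [F] and [b] for
    [G], precision [N] for the product follows from precision [N - b] for [F] and [N - a] for
    [G]. *)
Lemma sums_to_prod (I J : eqType) (F : I -> laurent) (G : J -> laurent) f g :
  sums_to F f -> sums_to G g -> sums_to (fun p => F p.1 * G p.2) (f * g).
Proof.
move=> hF hG N; have [a Fa] := sums_to_bound hF; have [b Gb] := sums_to_bound hG.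
have [s [us sF sf]] := hF (N - b); have [t [ut tG tg]] := hG (N - a).
exists [seq (i, j) | i <- s, j <- t]; split.
- by apply: allpairs_uniq => // -[? ?] [? ?] _ _ /= [-> ->].
- move=> [i j] ij; have [is_|/sF is_] := boolP (i \in s); last first.
    by rewrite -[N](subrK b); exact: vgeM.
  have [js|/tG js] := boolP (j \in t); last first.
    by rewrite -[N](subrK a) addrC; exact: vgeM.
  by case/negP: ij; apply/allpairsP; exists (i, j).
- rewrite big_allpairs_dep /=.
  have -> : \sum_(i <- s) \sum_(j <- t) F i * G j =
            (\sum_(i <- s) F i) * (\sum_(j <- t) G j).
    by rewrite mulr_suml; apply: eq_bigr => i _; rewrite mulr_sumr.
  set A := \sum_(i <- s) _ in sf *; set B := \sum_(j <- t) _ in tg *.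
  have gb : vge b g by exact: sums_to_vge hG _.
  have Aa : vge a A by exact: vge_sum.
  have -> : f * g - A * B = (f - A) * g + A * (g - B) by ring.
  apply: vgeD; first by rewrite -[N](subrK b); exact: vgeM.
  by rewrite -[N](subrK a) addrC; exact: vgeM.
Qed.

(** Zero terms do not affect a sum, so [f] only has to be a bijection between the supports. *)
Lemma sums_to_reindex (I J : eqType) (f : I -> J)
    (G : I -> laurent) (F : J -> laurent) g :
    (forall i i', G i != 0 -> G i' != 0 -> f i = f i' -> i = i') ->
    (forall i, G i != 0 -> F (f i) = G i) ->
    (forall j, F j != 0 -> exists2 i, f i = j & G i = F j) ->
  sums_to G g -> sums_to F g.
Proof.
move=> f_inj hG hF h N; have [s [us hs gs]] := h N.
pose s' := [seq i <- s | G i != 0].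
exists (map f s'); split.
- rewrite map_inj_in_uniq ?filter_uniq // => i j.
  by rewrite !mem_filter => /andP[Gi _] /andP[Gj _]; exact: f_inj.
- move=> j; have [->|Fj] := eqVneq (F j) 0; first by move=> _; exact: vge0.
  have [i fi Gi] := hF j Fj; rewrite -Gi => js; apply: hs; apply: contra js => js.
  by apply/mapP; exists i => //; rewrite mem_filter Gi Fj.
- rewrite big_map; have -> // : \sum_(i <- s') F (f i) = \sum_(i <- s) G i.
  rewrite big_filter [RHS](bigID (fun i => G i == 0)) /= [X in _ = X + _]big1 ?add0r.
    by apply: eq_bigr => i /hG.
  by move=> i /eqP.
Qed.

(** * Regrouping a sum along the fibres of a map *)

Section Fibres.
Variables (J K : eqType) (pi : J -> K) (F : J -> laurent) (g : K -> laurent).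
Hypothesis hfib : forall k, sums_to (fun j => if pi j == k then F j else 0) (g k).

Let vge_fib N s k : uniq s -> (forall j, j \notin s -> vge N (F j)) ->
  vge N (g k - \sum_(j <- s | pi j == k) F j).
Proof.
move=> us h; rewrite big_mkcond; apply: sums_to_any us _ => // j /h js.
by case: ifP.
Qed.

Let sum_fib (s : seq J) (t : seq K) : uniq t -> {subset map pi s <= t} ->
  \sum_(k <- t) \sum_(j <- s | pi j == k) F j = \sum_(j <- s) F j.
Proof.
move=> ut st; rewrite (exchange_big_dep predT) //=; apply: eq_big_seq => j js.
have pt : pi j \in t by apply: st; exact: map_f.
by rewrite big_mkcond (bigD1_seq (pi j)) //= eqxx big1 ?addr0 // => k /negPf; rewrite eq_sym => ->.
Qed.

Lemma sums_to_fibres v : sums_to F v -> sums_to g v.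
Proof.
move=> h N; have [s [us hs gs]] := h N; exists (undup (map pi s)); split.
- exact: undup_uniq.
- move=> k kt; have := vge_fib k us hs; rewrite big1_seq ?subr0 // => j /andP[/eqP jk js].
  by case/negP: kt; rewrite mem_undup -jk map_f.
- have := vgeD gs (vgeN (@vge_sum N _ (undup (map pi s)) xpredT _
    (fun k _ _ => vge_fib k us hs))).
  rewrite sumrB sum_fib ?undup_uniq // => [|k]; last by rewrite mem_undup.
  by congr vge; ring.
Qed.

Definition summable := forall N, exists s : seq J, forall j, j \notin s -> vge N (F j).

(** Summability of [F] is assumed separately: convergence on each fibre does not control infinitely
    many fibres at once, since terms may cancel inside a fibre. *)
Lemma sums_to_of_fibres v : summable -> sums_to g v -> sums_to F v.
Proof.
move=> smF h N; have [s0 hs0] := smF N; pose s := undup s0.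
have us : uniq s by exact: undup_uniq.
have hs : forall j, j \notin s -> vge N (F j) by move=> j; rewrite mem_undup; exact: hs0.
(* [t] is enlarged by the images of [s] so that the truncated fibres over [t] exhaust [s]. *)
have [t0 [ut0 ht0 gt0]] := h N; pose t := undup (t0 ++ map pi s).
exists s; split => //; rewrite -(@sum_fib s t) ?undup_uniq //; last first.
  by move=> k ks; rewrite mem_undup mem_cat ks orbT.
have gt : vge N (v - \sum_(k <- t) g k).
  apply: sums_to_any h _ _ => //; first exact: undup_uniq.
  by move=> k; rewrite mem_undup mem_cat negb_or => /andP[/ht0].
have := vgeD gt (@vge_sum N _ t xpredT _ (fun k _ _ => vge_fib k us hs)).
by rewrite sumrB; congr vge; ring.
Qed.

(** Only finitely many fibres contain a term of order below [N], and each contributes a finite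
    exceptional set. *)
Lemma summable_fibres :
    (forall N, exists t : seq K, forall j, pi j \notin t -> vge N (F j)) -> summable.
Proof.
move=> h N; have [t ht] := h N.
have /choice[S hS] k : exists s : seq J, forall j, j \notin s -> pi j = k -> vge N (F j).
  have [s [_ hs _]] := hfib k N; exists s => j /hs; by case: eqP.
exists (flatten (map S t)) => j js.
have [pt|/ht//] := boolP (pi j \in t).
apply: hS erefl; apply: contra js => js.
by apply/flattenP; exists (S (pi j)) => //; exact: map_f.
Qed.

End Fibres.

(** The value 0 on lists of different lengths lets a product of sums be expanded over all of
    [seq J], without tuples of prescribed length. *)
Fixpoint lprodf (J : Type) (Fs : seq (J -> laurent)) (js : seq J) : laurent :=
  match Fs, js with
  | [::], [::] => 1
  | F :: Fs, j :: js => F j * lprodf Fs js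
  | _, _ => 0
  end.

Lemma sums_to_lprodf (J A : eqType) (Fs : A -> J -> laurent) (gs : A -> laurent) s :
    (forall a, a \in s -> sums_to (Fs a) (gs a)) ->
  sums_to (lprodf (map Fs s)) (\prod_(a <- s) gs a).
Proof.
elim: s => [|a s IHs] h /=.
  rewrite big_nil; have := @sums_to_finite _ (lprodf [::]) [:: [::] : seq J] isT.
  by rewrite big_seq1; apply => -[].
have ha := h a (mem_head a s).
have {}IHs : sums_to (lprodf (map Fs s)) (\prod_(b <- s) gs b).
  by apply: IHs => b bs; apply: h; rewrite inE bs orbT.
rewrite big_cons; apply: (sums_to_reindex (f := fun p => p.1 :: p.2)) (sums_to_prod ha IHs).
- by move=> [i js] [i' js'] _ _ /= [-> ->].
- by case.
- by case=> [|j js]; [rewrite /= eqxx | exists (j, js)].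
Qed.

Lemma vge_prod (J : eqType) (s : seq J) (F : J -> laurent) (w : int) :
  (forall j, j \in s -> vge w (F j)) -> vge (w *+ size s) (\prod_(j <- s) F j).
Proof.
elim: s => [|j s IHs] h; first by rewrite big_nil; exact: lmonoP.
rewrite big_cons /= mulrS; apply: vgeM; first by apply: h; rewrite mem_head.
by apply: IHs => k ks; apply: h; rewrite inE ks orbT.
Qed.

Lemma vge_lprodf (J : Type) (A : eqType) (Fs : A -> J -> laurent) (s : seq A) js (w : int) :
  (forall a j, a \in s -> vge w (Fs a j)) -> vge (w *+ size s) (lprodf (map Fs s) js).
Proof.
elim: s js => [|a s IHs] [|j js] h //=; first exact: lmonoP.
rewrite mulrS; apply: vgeM; first by apply: h; rewrite mem_head.
by apply: IHs => b k bs; apply: h; rewrite inE bs orbT.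
Qed.

Lemma sums_to_of_lser (J : eqType) (F : J -> lser) (g : lser) :
  lhas_sum F g -> sums_to (fun j => of_lser (F j)) (of_lser g).
Proof.
move=> [smF hF] N; have [s hs] := smF N; exists (undup s).
have out j n : j \notin undup s -> n < N -> lcoef (F j) n = 0.
  rewrite mem_undup => js nN; apply/eqP; apply: contraNT js => Fn.
  by apply: hs; exists n.
split=> [|j js n nN|n nN]; [exact: undup_uniq|exact: out|].
have [t [ut ht gt]] := hF n.
rewrite lcD lcN lc_sum /= gt; apply/eqP; rewrite subr_eq0; apply/eqP.
(* The finite set for degree [n] and the one for precision [N] may differ; once vanishing
   coefficients are discarded, both run over the same indices. *)
rewrite (bigID (fun j => lcoef (F j) n == 0)) /= [X in X + _]big1 ?add0r;
  last by move=> j /eqP.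
rewrite [RHS](bigID (fun j => lcoef (F j) n == 0)) /= [X in _ = X + _]big1 ?add0r;
  last by move=> j /eqP.
rewrite -big_filter -[RHS]big_filter; apply: perm_big;
  apply: uniq_perm; rewrite ?filter_uniq ?undup_uniq //.
move=> j; rewrite !mem_filter; case: (eqVneq (lcoef (F j) n) 0) => //= Fn.
rewrite ht //; apply/esym; apply: contraNT Fn => js; exact/eqP/out.
Qed.

Lemma lhas_sum_of (J : eqType) (F : J -> lser) (g : lser) :
  sums_to (fun j => of_lser (F j)) (of_lser g) -> lhas_sum F g.
Proof.
move=> h; split=> [N|n].
  have [s [_ hs _]] := h N; exists s => j [n nN]; apply: contraR => js.
  exact/eqP/(hs j js n nN).
have [s [us hs gs]] := h (n + 1); have nn : n < n + 1 by rewrite ltrDl.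
exists s; split=> // [j|].
  by apply: contraR => js; exact/eqP/(hs j js n nn).
by have /eqP := gs n nn; rewrite lcD lcN lc_sum subr_eq0 => /eqP.
Qed.

(** * Monomials and geometric series *)

Definition xm (N : int) : laurent := of_lser (lmono N).

Lemma vge_xm N : vge N (xm N).
Proof. exact: lmonoP. Qed.

Lemma lc_xmM a f n : lc (xm a * f) n = lc f (n - a).
Proof.
have [v fv] := vge_exists f; have [nlt|nge] := ltP n (a + v).
  by rewrite (vgeM (@vge_xm a) fv) // fv //; lia.
have -> : n = a + v + (absz (n - (a + v))%R)%:Z by lia.
rewrite [LHS](lc_lmultE (@vge_xm a) fv (ltnSn _)).
set m := absz _; have -> : \poly_(i < m.+1) lc (xm a) (a + i%:Z) = 1.
  apply/polyP => i; rewrite coef_poly coef1 /= /lmono_coef.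
  by rewrite -[X in _ == X]addr0 (inj_eq (addrI a)); case: i => // i; case: ifP.
by rewrite mul1r coef_poly ltnSn; congr lc; lia.
Qed.

Lemma xmD a b : xm (a + b) = xm a * xm b.
Proof.
by apply: laurentP => n; rewrite lc_xmM /= /lmono_coef; congr (_%:R); lia.
Qed.

Lemma xm0 : xm 0 = 1. Proof. by []. Qed.

Lemma xm_sum (I : Type) (s : seq I) (f : I -> int) :
  xm (\sum_(i <- s) f i) = \prod_(i <- s) xm (f i).
Proof. exact: (big_morph xm xmD xm0). Qed.

Lemma of_lser_prod (A : Type) (s : seq A) (F : A -> lser) :
  of_lser (lprod (map F s)) = \prod_(a <- s) of_lser (F a).
Proof. by elim: s => [|a s IHs]; rewrite ?big_nil // big_cons -IHs; exact: of_lser_mul. Qed.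

Lemma geometric_nat (a : nat) : (0 < a)%N ->
  (* Since [a] is at least 1, an index [i] with [i >= |N|] gives an exponent [a * i >= N]; hence the
     exceptional set [iota 0 |N|]. *)
  sums_to (fun i : nat => - xm (a%:Z * i%:Z)) (of_lser (linv_xa_m1 a)).
Proof.
move=> a0 N; exists (iota 0 (absz N)); split=> [|i|n nN]; first exact: iota_uniq.
  rewrite mem_iota add0n /= -leqNgt => Ni; apply: vgeN; apply: vge_le (@vge_xm _).
  by nia.
rewrite lcD lcN lc_sum /= /linv_xa_m1_coef.
have [n0|n0] /= := leP 0 n; last first.
  rewrite big1 ?subr0 // => i _; rewrite /lmono_coef; case: eqP => [e|]; last by rewrite oppr0.
  by exfalso; nia.
have [/dvdzP[q nq]|nd] := boolP (a%:Z %| n)%Z.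
  have qi : absz q \in iota 0 (absz N) by rewrite mem_iota; nia.
  rewrite (bigD1_seq (absz q)) ?iota_uniq //= big1 => [|i iq]; rewrite /lmono_coef.
    have -> : n == a%:Z * (absz q)%:Z by apply/eqP; nia.
    by rewrite addr0 subrr.
  by case: eqP => [e|]; rewrite ?oppr0 //; exfalso; move: iq; nia.
rewrite big1 ?subr0 // => i _; rewrite /lmono_coef; case: eqP => [e|]; rewrite ?oppr0 //.
by case/negP: nd; rewrite e dvdz_mulr.
Qed.

(** The integers above [f] start at [f + 1], so this is a shifted geometric series. The shift by 1
    is the source of the summand 2n(R) - n(R_1) - n(R_r) in M'. *)
Lemma geometric_int (a : nat) (f : int) : (0 < a)%N ->
  sums_to (fun D : int => if f < D then - xm (a%:Z * D) else 0)
          (xm (a%:Z * (f + 1)) * of_lser (linv_xa_m1 a)).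
Proof.
move=> a0; rewrite mulrC; apply: (sums_to_reindex (f := fun i : nat => f + 1 + i%:Z))
  (sums_to_scale (xm (a%:Z * (f + 1))) (geometric_nat a0)) => [i i' _ _|i _|D].
- lia.
- rewrite ifT; last by lia.
  by rewrite mulNr -xmD; congr (- xm _); ring.
- case: ifP => [fD _|_ /eqP//]; exists (absz (D - (f + 1))%R); first by lia.
  by rewrite mulNr -xmD; congr (- xm _); rewrite -mulrDr; congr (_ * _); lia.
Qed.

(** * Sums over the ordered pairs of a sequence *)

Section PairSum.
Variables (T : Type) (V : zmodType) (f : T -> T -> V).

Fixpoint pairsum (s : seq T) : V :=
  if s is x :: s' then \sum_(y <- s') f x y + pairsum s' else 0.

Lemma pairsum_nth (x0 : T) s :
  \sum_(l < size s) \sum_(k < size s | (l < k)%N) f (nth x0 s l) (nth x0 s k) = pairsum s.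
Proof.
elim: s => [|x s IHs] /=; first by rewrite big_ord0.
rewrite big_ord_recl /=; congr (_ + _).
  by rewrite big_mkcond big_ord_recl /= add0r (big_nth x0) big_mkord.
rewrite -IHs; apply: eq_bigr => l _.
by rewrite big_mkcond big_ord_recl /= add0r [RHS]big_mkcond.
Qed.

Lemma pairsum_cat s t :
  pairsum (s ++ t) = pairsum s + pairsum t + \sum_(x <- s) \sum_(y <- t) f x y.
Proof.
elim: s => [|x s IHs] /=; first by rewrite big_nil add0r addr0.
rewrite big_cat IHs big_cons /= -!addrA; congr (_ + _).
by rewrite addrCA; congr (_ + _); rewrite addrCA.
Qed.

End PairSum.

(** * Merging blocks of a partition *)

Section Data.
Variables (S : finType) (P0 : S) (m : S -> nat) (rR : realType) (alpha : S -> nat -> rR).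
Notation data := (dataT S).
Notation item := (dataT S * int)%type.
Notation isd := (is_data m P0).
Notation nd := (nd P0).
Notation alphad := (alphad alpha).

(** The total of the parts, with lists cut to length [m P], so that being a partition of [X] becomes
    an equation between data. *)
Definition cdata (ps : seq data) : data :=
  [ffun P => mkseq (fun i => \sum_(Y <- ps) nth 0 (Y P) i)%N (m P)].

Lemma nth_cdata ps P i : (i < m P)%N ->
  nth 0%N (cdata ps P) i = (\sum_(Y <- ps) nth 0 (Y P) i)%N.
Proof. by move=> im; rewrite ffunE nth_mkseq. Qed.

Lemma size_data X P : isd X -> size (X P) = m P.
Proof. by case/andP => /andP[/forallP h _ _]; exact/eqP/h. Qed.

Lemma sumn_data X P : isd X -> sumn (X P) = nd X.
Proof. by case/andP => /andP[_ /forallP h _]; exact/eqP/h. Qed.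

Lemma nd_gt0 X : isd X -> (0 < nd X)%N.
Proof. by case/andP. Qed.

Lemma sumn_nth_data X P : isd X -> sumn (X P) = (\sum_(i < m P) nth 0 (X P) i)%N.
Proof. by move=> dX; rewrite sumnE (big_nth 0%N) big_mkord size_data. Qed.

Lemma sumn_cdata ps P : all isd ps -> sumn (cdata ps P) = (\sum_(Y <- ps) nd Y)%N.
Proof.
move=> /allP dps; rewrite ffunE sumnE big_map -{1}[m P]subn0 -/(index_iota 0 (m P)).
rewrite big_mkord exchange_big; apply: eq_big_seq => Y /dps dY /=.
by rewrite -sumn_nth_data // (sumn_data P dY).
Qed.

Lemma nd_cdata ps : all isd ps -> nd (cdata ps) = (\sum_(Y <- ps) nd Y)%N.
Proof. exact: sumn_cdata. Qed.

Lemma alphad_data X : isd X ->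
  alphad X = \sum_(P : S) \sum_(i < m P) (nth 0%N (X P) i)%:R * alpha P i.
Proof. by move=> dX; apply: eq_bigr => P _; rewrite size_data. Qed.

Lemma alphad_cdata ps : all isd ps -> alphad (cdata ps) = \sum_(Y <- ps) alphad Y.
Proof.
move=> /allP dps; rewrite [RHS](eq_big_seq _ (fun Y h => alphad_data (dps Y h))).
rewrite exchange_big; apply: eq_bigr => P _ /=; rewrite ffunE size_mkseq exchange_big.
by apply: eq_bigr => i _; rewrite nth_mkseq // natr_sum mulr_suml.
Qed.

Lemma is_data_cdata ps : ps != [::] -> all isd ps -> isd (cdata ps).
Proof.
move=> ps0 dps; rewrite /is_data -andbA; apply/and3P; split.
- by apply/forallP => P; rewrite ffunE size_mkseq.
- by apply/forallP => P; rewrite sumn_cdata // nd_cdata.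
- rewrite nd_cdata //; case: ps ps0 dps => // Y ps _ /andP[/nd_gt0 Y0 _].
  by rewrite big_cons ltn_addr.
Qed.

Lemma is_partitionE X ps : isd X ->
  is_partition m P0 X ps = [&& ps != [::], all isd ps & X == cdata ps].
Proof.
move=> dX; rewrite /is_partition -andbA; congr [&& _, _ & _].
apply/forallP/eqP => [h|-> P]; last first.
  apply/allP => i; rewrite mem_iota add0n /= => im.
  by rewrite nth_cdata.
apply/ffunP => P; apply: (@eq_from_nth _ 0%N) => [|i].
  by rewrite size_data // ffunE size_mkseq.
rewrite size_data // => im; rewrite nth_cdata //.
by have /allP/(_ i) := h P; rewrite mem_iota im => /(_ isT)/eqP.
Qed.

Lemma cdata1 Y : isd Y -> cdata [:: Y] = Y.
Proof.
move=> dY; apply/ffunP => P; apply: (@eq_from_nth _ 0%N) => [|i].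
  by rewrite ffunE size_mkseq size_data.
by rewrite {1}ffunE size_mkseq => im; rewrite nth_cdata // big_seq1.
Qed.

Lemma cdata_flatten pss : cdata (flatten pss) = cdata (map cdata pss).
Proof.
apply/ffunP => P; rewrite !ffunE; apply/eq_in_map => i.
rewrite mem_iota add0n /= => im; rewrite big_flatten big_map.
by apply: eq_bigr => ps _; rewrite nth_cdata.
Qed.

Definition sig2 (Y Z : data) : int :=
  \sum_(P : S) \sum_(i < m P) \sum_(t < m P | (t < i)%N)
    (nth 0%N (Z P) i * nth 0%N (Y P) t)%:Z.

Lemma sig2_suml ps Z : sig2 (cdata ps) Z = \sum_(Y <- ps) sig2 Y Z.
Proof.
rewrite exchange_big; apply: eq_bigr => P _; rewrite exchange_big; apply: eq_bigr => i _.
rewrite exchange_big; apply: eq_bigr => t _; rewrite nth_cdata // big_distrr /=.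
exact: (big_morph Posz PoszD).
Qed.

Lemma sig2_sumr Y ps : sig2 Y (cdata ps) = \sum_(Z <- ps) sig2 Y Z.
Proof.
rewrite exchange_big; apply: eq_bigr => P _; rewrite exchange_big; apply: eq_bigr => i _.
rewrite exchange_big; apply: eq_bigr => t _; rewrite nth_cdata // big_distrl /=.
exact: (big_morph Posz PoszD).
Qed.

Lemma sigmaI_pairsum ps : (sigmaI m ps)%:Z = pairsum sig2 ps.
Proof.
rewrite -(pairsum_nth _ (data0 S)) /sigmaI (big_morph Posz PoszD (erefl _)).
under eq_bigr do rewrite (big_morph Posz PoszD (erefl _)).
rewrite exchange_big; apply: eq_bigr => l _ /=.
under eq_bigr do rewrite (big_morph Posz PoszD (erefl _)).
rewrite exchange_big; apply: eq_bigr => k _ /=; apply: eq_bigr => P _.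
rewrite (big_morph Posz PoszD (erefl _)); apply: eq_bigr => i _.
by rewrite (big_morph Posz PoszD (erefl _)).
Qed.

Definition ipair (p q : item) : int := p.2 * (nd q.1)%:Z - q.2 * (nd p.1)%:Z.
(** The contribution to N of a pair of positions, [p] before [q]. It is biadditive, which makes N
    additive along blocks. *)
Definition npair (p q : item) : int := ipair p q - sig2 p.1 q.1.

Lemma pairsum_map (T T' : Type) (V : zmodType) (f : T' -> T' -> V) (h : T -> T') s :
  pairsum f (map h s) = pairsum (fun x y => f (h x) (h y)) s.
Proof. by elim: s => //= x s ->; rewrite big_map. Qed.

Lemma pairsumB (T : Type) (V : zmodType) (f g : T -> T -> V) s :
  pairsum (fun x y => f x y - g x y) s = pairsum f s - pairsum g s.
Proof.
by elim: s => [|x s IHs] /=; rewrite ?subr0 // IHs sumrB opprD addrACA.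
Qed.

Lemma NRI_pairsum (c : seq item) : NRI m P0 (map fst c) (map snd c) = pairsum npair c.
Proof.
rewrite /NRI sigmaI_pairsum pairsum_map pairsumB; congr (_ - _).
rewrite -(pairsum_nth _ (data0 S, 0)) size_map; apply: eq_bigr => l _.
by apply: eq_bigr => k _; rewrite /ipair /part !(nth_map (data0 S, 0 : int)).
Qed.

Definition merge (b : seq item) : item := (cdata (map fst b), \sum_(p <- b) p.2).

Definition alldata (b : seq item) := all (fun p => isd p.1) b.

Lemma alldata_map b : all isd (map fst b) = alldata b.
Proof. by rewrite all_map. Qed.

Lemma nd_merge b : alldata b -> nd (merge b).1 = (\sum_(p <- b) nd p.1)%N.
Proof. by move=> db; rewrite nd_cdata ?alldata_map // big_map. Qed.

Lemma is_data_merge b : b != [::] -> alldata b -> isd (merge b).1.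
Proof. by move=> b0 db; rewrite is_data_cdata ?alldata_map //; case: b b0 {db}. Qed.

Lemma merge1 p : isd p.1 -> merge [:: p] = p.
Proof. by case: p => Y e dY; rewrite /merge /= cdata1 // big_seq1. Qed.

Lemma npair_merge b b' : alldata b -> alldata b' ->
  npair (merge b) (merge b') = \sum_(p <- b) \sum_(q <- b') npair p q.
Proof.
move=> db db'; rewrite /npair /ipair !nd_merge //= !(big_morph Posz PoszD (erefl _)).
under [RHS]eq_bigr do rewrite !sumrB.
rewrite !sumrB; congr (_ - _ - _).
- by rewrite mulr_suml; apply: eq_bigr => p _; rewrite mulr_sumr.
- by rewrite exchange_big mulr_suml; apply: eq_bigr => q _; rewrite mulr_sumr.
- by rewrite sig2_suml big_map; apply: eq_bigr => p _; rewrite sig2_sumr big_map.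
Qed.

(** A pair of positions lies either inside one block or in two different blocks; by biadditivity the
    latter pairs add up to the pairs of merged blocks. *)
Lemma pairsum_merge jj : all alldata jj ->
  pairsum npair (flatten jj) = pairsum npair (map merge jj) + \sum_(b <- jj) pairsum npair b.
Proof.
elim: jj => [|b jj IHjj] /=; first by rewrite big_nil addr0.
case/andP => db djj; rewrite pairsum_cat IHjj // big_cons big_map.
have -> : \sum_(x <- b) \sum_(y <- flatten jj) npair x y =
         \sum_(b' <- jj) npair (merge b) (merge b').
  under eq_bigr do rewrite big_flatten.
  rewrite exchange_big; apply: eq_big_seq => b' /(allP djj) db' /=.
  by rewrite npair_merge.
by ring.
Qed.

Section Blocks.
Variable T : eqType.
Implicit Types (p : T) (j : seq T) (jj : seq (seq T)).

Definition attach p jj := if jj is b :: jj' then (p :: b) :: jj' else [:: [:: p]].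

(** Each element either opens a block of its own or joins the first block of the rest. For the last
    element only [attach] is used, since both choices would give the same blocking. *)
Fixpoint blockings j : seq (seq (seq T)) :=
  if j is p :: j' then
    (if j' is [::] then [::] else [seq [:: p] :: jj | jj <- blockings j'])
    ++ [seq attach p jj | jj <- blockings j']
  else [:: [::]].

Lemma mem_blockings j jj :
  (jj \in blockings j) = (flatten jj == j) && all (fun b => b != [::]) jj.
Proof.
elim: j jj => [|p j IHj] jj.
  by rewrite inE; case: jj => [|[|x b] jj] /=; rewrite ?andbF.
have attachP : jj \in [seq attach p kk | kk <- blockings j] =
   (if jj is (x :: b) :: jj' then (x == p) && (if b is [::] then (j == [::]) && (jj' == [::])
     else (b :: jj' \in blockings j)) else false).
  apply/mapP/idP => [[kk]|].
    move=> hk ->; have := hk; rewrite IHj => /andP[/eqP ej].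
    by case: kk hk ej => [|[|y b] kk] //= hk ej _; [rewrite -ej !eqxx|rewrite eqxx].
  case: jj => [|[|x [|y b]] jj] // /andP[/eqP->].
    by case/andP => /eqP-> /eqP->; exists [::]; rewrite ?inE.
  by move=> h; exists ((y :: b) :: jj).
rewrite /= mem_cat attachP => {attachP}.
have consP : jj \in (if j is [::] then [::] else [seq [:: p] :: kk | kk <- blockings j]) =
   (if jj is (x :: b) :: jj'
    then [&& x == p, b == [::], j != [::] & jj' \in blockings j] else false).
  case: j IHj => [|q j] IHj; first by case: jj => [|[|x b] jj]; rewrite ?andbF.
  apply/mapP/idP => [[kk hk ->]|]; first by rewrite eqxx.
  by case: jj => [|[|x b] jj] // /and4P[/eqP-> /eqP-> _ hk]; exists jj.
rewrite consP => {consP}; case: jj => [|[|x b] jj] //=; first by rewrite andbF.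
rewrite eqseq_cons; case: eqP => //= _; case: b => [|y b] /=; last first.
  by rewrite IHj.
rewrite IHj; case: j {IHj} => [|q j] /=; last by rewrite orbF.
by case: jj => [|[|y b] jj] //=; rewrite andbF.
Qed.

Lemma uniq_blockings j : uniq (blockings j).
Proof.
elim: j => //= p j IHj; rewrite cat_uniq; apply/and3P; split.
- by case: j IHj => // q j IHj; rewrite map_inj_uniq // => u v [].
- apply/hasPn => _ /mapP[kk hk ->]; case: j IHj hk => // q j IHj hk.
  apply/mapP => -[kk' hk']; move: hk; rewrite mem_blockings.
  by case: kk => [|[|y b] kk] // /andP[].
- rewrite map_inj_in_uniq // => u v; rewrite !mem_blockings.
  by case: u => [|[|x b] u]; case: v => [|[|y c] v]; rewrite ?andbF //=; congruence.
Qed.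

End Blocks.

(** * Cancellation over the ways of cutting a sequence into blocks *)

Section Slopes.
Variable lam : rR.
Notation slope := (slope alpha P0).

(** Has the sign of the slope minus lambda but, unlike the slope, is additive. *)
Definition excess (p : item) : rR := p.2%:~R + alphad p.1 - lam * (nd p.1)%:R.

Lemma excess_slope p : isd p.1 -> excess p = (slope p - lam) * (nd p.1)%:R.
Proof.
move=> /nd_gt0 n0; rewrite /excess /slope mulrBl divfK //.
by rewrite pnatr_eq0 -lt0n.
Qed.

Lemma excess_merge b : alldata b -> excess (merge b) = \sum_(p <- b) excess p.
Proof.
move=> db; rewrite /excess nd_merge //= alphad_cdata ?alldata_map // big_map.
by rewrite natr_sum mulr_sumr sumrB big_split /= rmorph_sum.
Qed.

(** The argument [h] accumulates the excess of what precedes [c]. The whole sequence is not tested,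
    only its proper initial segments. *)
Fixpoint cone (h : rR) (c : seq item) : bool :=
  if c is p :: c' then (c' == [::]) || ((0 < h + excess p) && cone (h + excess p) c')
  else true.

Definition decreasing (b : seq item) := sorted (fun u v => v < u) (map slope b).
Arguments decreasing : simpl never.

(** The sign of a blocking is -1 to the number of its cuts. *)
Definition bweight (h : rR) (jj : seq (seq item)) : int :=
  if all decreasing jj && cone h (map merge jj) then (-1) ^+ (size jj).-1 else 0.

(** The gap between [p] and [p'] decides independently of the rest: leaving it uncut requires a drop
    of slope, cutting it requires positive excess so far and costs a sign. *)
Lemma sum_bweight_cons h p p' j : alldata [:: p, p' & j] ->
  \sum_(jj <- blockings [:: p, p' & j]) bweight h jj =
  ((slope p' < slope p)%R%:R - (0 < h + excess p)%R%:R) *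
    \sum_(jj <- blockings (p' :: j)) bweight (h + excess p) jj.
Proof.
case/andP => dp dj; have -> : blockings [:: p, p' & j] =
  [seq [:: p] :: jj | jj <- blockings (p' :: j)] ++ [seq attach p jj | jj <- blockings (p' :: j)].
  by [].
set B := blockings (p' :: j).
rewrite big_cat !big_map /= [LHS]addrC mulrBl !mulr_sumr -sumrN.
congr (_ + _); apply: eq_big_seq => jj; rewrite /B mem_blockings => /andP[/eqP ej].
- case: jj ej => [|[|x b] jj] //= [ex ej] _; subst x.
  rewrite /bweight /=.
  have -> : decreasing [:: p, p' & b] = (slope p' < slope p) && decreasing (p' :: b) by [].
  case: (slope p' < slope p); last by rewrite mul0r.
  rewrite mul1r.
  have [db djj] : alldata (p' :: b) /\ alldata (flatten jj).
    by apply/andP; rewrite -all_cat /= ej.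
  have -> : excess (merge [:: p, p' & b]) = excess p + excess (merge (p' :: b)).
    by rewrite !excess_merge ?big_cons //= dp.
  by rewrite !addrA.
- case: jj ej => [|b jj] //= ej _.
  rewrite /bweight /= merge1 //.
  case: (0 < h + excess p) => /=; last by rewrite andbF mul0r oppr0.
  by rewrite mul1r; case: ifP; rewrite ?oppr0 // exprS mulN1r.
Qed.

Lemma excess_lt0 p : isd p.1 -> (excess p < 0) = (slope p < lam).
Proof. by move=> dp; rewrite excess_slope // pmulr_llt0 ?subr_lt0 // ltr0n nd_gt0. Qed.

Lemma excess_gt0 p : isd p.1 -> (0 < excess p) = (lam < slope p).
Proof. by move=> dp; rewrite excess_slope // pmulr_lgt0 ?subr_gt0 // ltr0n nd_gt0. Qed.

(** A cut after [p] is forbidden, so a nonzero factor forces the next slope below lambda. The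
    accumulated excess then keeps falling and the total would end negative. *)
Lemma sum_bweight_neg h p p' j : alldata [:: p, p' & j] ->
    slope p <= lam -> h + excess p <= 0 ->
    0 <= h + \sum_(q <- [:: p, p' & j]) excess q ->
  \sum_(jj <- blockings [:: p, p' & j]) bweight h jj = 0.
Proof.
elim: j h p p' => [|p'' j IHj] h p p' dj sp hp tot; rewrite sum_bweight_cons //;
  have /and3P[dp dp' dj'] := dj; rewrite (le_gtF hp) subr0.
- case: ltP => [sp'|_]; last by rewrite mul0r.
  have := lt_le_trans sp' sp; rewrite -excess_lt0 // => hp'.
  by exfalso; move: tot; rewrite !big_cons big_nil; lra.
- case: ltP => [sp'|_]; last by rewrite mul0r.
  have sp'l := lt_le_trans sp' sp; have := sp'l; rewrite -excess_lt0 // => hp'.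
  rewrite IHj ?mulr0 //; [by rewrite /= dp'|exact: ltW|by lra|].
  by move: tot; rewrite !big_cons; lra.
Qed.

(** A cut after [p] is always allowed, so the factor vanishes when the slope drops. Otherwise the
    next slope stays above lambda and the total would end positive. *)
Lemma sum_bweight_pos h p p' j : alldata [:: p, p' & j] ->
    lam < slope p -> 0 < h + excess p ->
    h + \sum_(q <- [:: p, p' & j]) excess q <= 0 ->
  \sum_(jj <- blockings [:: p, p' & j]) bweight h jj = 0.
Proof.
elim: j h p p' => [|p'' j IHj] h p p' dj sp hp tot; rewrite sum_bweight_cons //;
  have /and3P[dp dp' dj'] := dj; rewrite hp.
- case: ltP => [_|sp']; first by rewrite subrr mul0r.
  have := lt_le_trans sp sp'; rewrite -excess_gt0 // => hp'.
  by exfalso; move: tot; rewrite !big_cons big_nil; lra.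
- case: ltP => [_|sp']; first by rewrite subrr mul0r.
  have sp'l := lt_le_trans sp sp'; have := sp'l; rewrite -excess_gt0 // => hp'.
  rewrite IHj ?mulr0 //; [by rewrite /= dp'|by lra|].
  by move: tot; rewrite !big_cons; lra.
Qed.

Lemma sum_bweight_eq0 j : alldata j -> \sum_(q <- j) excess q = 0 -> (1 < size j)%N ->
  \sum_(jj <- blockings j) bweight 0 jj = 0.
Proof.
case: j => [|p [|p' j]] // dj tot _; have /andP[dp _] := dj.
have [sp|sp] := leP (slope p) lam.
- apply: sum_bweight_neg; rewrite ?add0r ?tot //.
  by rewrite leNgt excess_gt0 // -leNgt.
- by apply: sum_bweight_pos; rewrite ?add0r ?tot ?excess_gt0.
Qed.

End Slopes.

(** * Orders bounded below uniformly in the degree *)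

Section Bounds.
Variable Qd : data -> int -> lser.
Notation slope := (slope alpha P0).

Definition hn (p : item) (b : seq item) : laurent :=
  of_lser (hyp_term m alpha P0 Qd p.1 p.2 b).

Definition hnterm (b : seq item) : laurent :=
  xm (pairsum npair b) * \prod_(p <- b) of_lser (Qd p.1 p.2).

Lemma hnE p b : hn p b =
  if is_partition m P0 p.1 (map fst b) && (\sum_(q <- b) q.2 == p.2) && decreasing b
  then hnterm b else 0.
Proof.
rewrite /hn /hyp_term -/(decreasing b); case: ifP => // _.
by rewrite of_lser_mul NRI_pairsum of_lser_prod.
Qed.

Lemma hnterm1 p : hnterm [:: p] = of_lser (Qd p.1 p.2).
Proof. by rewrite /hnterm /= big_nil big_seq1 addr0 xm0 mul1r. Qed.

Lemma hn1 p : isd p.1 -> hn p [:: p] = of_lser (Qd p.1 p.2).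
Proof.
by move=> dp; rewrite hnE is_partitionE //= dp cdata1 // eqxx big_seq1 eqxx hnterm1.
Qed.

(** Clearing denominators in slope(p) > slope(q) bounds d_p n_q - d_q n_p below by alpha_q n_p -
    alpha_p n_q, which is free of degrees. *)
Definition pair_bound (Y Z : data) : int :=
  Num.floor (alphad Z * (nd Y)%:R - alphad Y * (nd Z)%:R) - sig2 Y Z.

Lemma npair_bound p q : isd p.1 -> isd q.1 -> slope q < slope p ->
  pair_bound p.1 q.1 <= npair p q.
Proof.
move=> dp dq; rewrite /slope ltr_pdivrMr ?ltr0n ?nd_gt0 // mulrAC.
rewrite ltr_pdivlMr ?ltr0n ?nd_gt0 // => pq.
rewrite lerB // -(ler_int rR); apply: le_trans (floor_le _) _.
rewrite /ipair rmorphB !rmorphM /= -!pmulrn; lra.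
Qed.

Lemma pairsum_bound b : alldata b -> decreasing b ->
  pairsum pair_bound (map fst b) <= pairsum npair b.
Proof.
(* N involves all pairs, not only adjacent ones, so the slopes are compared pairwise. *)
rewrite /decreasing sorted_pairwise; last by move=> y x z xy yz; exact: lt_trans yz xy.
elim: b => //= p b IHb /andP[dp db] /andP[pb bb]; apply: lerD; last exact: IHb.
rewrite big_map !big_seq; apply: ler_sum => q qb; apply: npair_bound => //.
  exact: (allP db).
by have /allP := pb; apply; exact: map_f.
Qed.

Lemma nd_partition X ps : isd X -> is_partition m P0 X ps -> nd X = (\sum_(Y <- ps) nd Y)%N.
Proof.
by move=> dX; rewrite is_partitionE // => /and3P[_ dps /eqP->]; rewrite nd_cdata.
Qed.

(** Every part has positive n, so there are at most n(X) parts, and all entries are at most n(X).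
    Partitions are thus encoded by bounded tuples over a finite type. *)
Lemma partitions_finite X : isd X ->
  exists PL : seq (seq data), forall ps, is_partition m P0 X ps -> ps \in PL.
Proof.
move=> dX; set n := nd X; pose K := \max_(P : S) m P.
pose C := {ffun S * 'I_K -> 'I_n.+1}.
pose dec (c : C) : data :=
  [ffun P => mkseq (fun i => if insub i is Some i' then nat_of_ord (c (P, i')) else 0%N) (m P)].
pose enc (Y : data) : C := [ffun x : S * 'I_K => inord (nth 0%N (Y x.1) x.2)].
have encK Y : isd Y -> (nd Y <= n)%N -> dec (enc Y) = Y.
  move=> dY Yn; apply/ffunP => P; apply: (@eq_from_nth _ 0%N) => [|i].
    by rewrite ffunE size_mkseq size_data.
  rewrite {1}ffunE size_mkseq => im; rewrite ffunE nth_mkseq //.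
  have iK : (i < K)%N by apply: leq_trans im _; exact: leq_bigmax.
  rewrite insubT ffunE /= inordK // ltnS; apply: leq_trans Yn.
  by rewrite -(sumn_data P dY) sumn_nth_data // (bigD1 (Ordinal im)) //= leq_addr.
exists (flatten [seq [seq map dec (tval t) | t : r.-tuple C] | r <- iota 0 n.+1]).
move=> ps hps; have nX := nd_partition dX hps.
have := hps; rewrite is_partitionE // => /and3P[_ /allP dps _].
have szps : (size ps < n.+1)%N.
  rewrite ltnS /n nX -sum1_size big_seq [X in (_ <= X)%N]big_seq; apply: leq_sum => Y /dps.
  exact: nd_gt0.
apply/flattenP; exists [seq map dec (tval t) | t : (size ps).-tuple C].
  by apply/mapP; exists (size ps) => //; rewrite mem_iota.
apply/mapP; exists [tuple of map enc (in_tuple ps)]; first by rewrite mem_enum.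
rewrite /= -map_comp -[LHS]map_id; apply/eq_in_map => Y Yps /=.
rewrite encK ?dps //.
by rewrite /n nX (big_rem Y) //= leq_addr.
Qed.

Lemma hn_vge_of_lt Y : isd Y ->
    (forall Z, isd Z -> (nd Z < nd Y)%N -> exists w, forall e, vge w (of_lser (Qd Z e))) ->
  exists w, forall e b, b != [:: (Y, e)] -> vge w (hn (Y, e) b).
Proof.
move=> dY IH; have [PL hPL] := partitions_finite dY.
pose P ps w := forall e b, map fst b = ps -> b != [:: (Y, e)] -> vge w (hn (Y, e) b).
have [||w hw] := @exists_uniform_bound _ PL P.
- by move=> ps a b le_ab h e c hc hc1; apply: vge_le (h e c hc hc1).
- move=> ps _; have [hps|nps] := boolP (is_partition m P0 Y ps); last first.
    exists 0 => e b eb _; rewrite hnE /= eb (negPf nps); exact: vge0.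
  have nY := nd_partition dY hps.
  have := hps; rewrite is_partitionE // => /and3P[ps0 dps /eqP eY].
  (* With a single part the degree is forced to be [e], so the only nonzero term would be the
     excluded one. *)
  case: ps ps0 dps eY nY hps => [|Z [|Z' ps]] // _.
    rewrite /= andbT => dZ; rewrite cdata1 // => <- _ _; exists 0 => e b eb nb.
    rewrite hnE /=; case: ifP => [/andP[/andP[_ /eqP se] _]|_]; last exact: vge0.
    by case: b eb nb se => [|[Z1 e1] [|? ?]] //= [<-];
      rewrite big_seq1 /= => nb se; case/eqP: nb; rewrite se.
  set ps' := [:: Z, Z' & ps] => dps _ nY hps.
  have [|//|W hW] := @exists_uniform_bound _ ps' (fun Z w => forall e, vge w (of_lser (Qd Z e))).
  + by move=> ? a b le_ab h e; exact: vge_le (h e).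
  (* At least one further part remains and has positive n, so [V] is strictly smaller than [Y]. *)
  + move=> V Vps; apply: IH; first exact: (allP dps).
    rewrite nY (big_rem V) // -{1}[nd V]addn0 ltn_add2l.
    have : rem V ps' != [::] by rewrite -size_eq0 size_rem.
    case ers: (rem V ps') => [|U rs] // _; rewrite big_cons ltn_addr //.
    by apply/nd_gt0/(allP dps)/(mem_rem (x := V)); rewrite ers mem_head.
  exists (pairsum pair_bound ps' + W *+ size ps') => e b eb _.
  rewrite hnE eb; case: ifP => [/andP[/andP[_ _] db]|_]; last exact: vge0.
  apply: vgeM.
    apply: vge_le (@vge_xm _); rewrite -eb; apply: pairsum_bound => //.
    by rewrite -alldata_map eb.
  have -> : size ps' = size b by rewrite -eb size_map.
  by apply: vge_prod => p pb; apply: hW; rewrite -eb map_f.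
exists w => e b nb; have [hb|/negPf hb] := boolP (is_partition m P0 Y (map fst b)).
  by apply: hw nb => //; exact: hPL.
by rewrite hnE /= hb; exact: vge0.
Qed.

Variable Q : data -> lser.
Hypothesis hQ : forall (X : data) (d : int), isd X ->
  sums_to (hn (X, d)) (of_lser (Q X)).

(** In the recursion, Q_(Y,e) is Q_Y minus the terms of the nontrivial partitions. The former does
    not depend on [e], and the latter are bounded uniformly by induction on n(Y). *)
Lemma Qd_vge Y : isd Y -> exists w, forall e, vge w (of_lser (Qd Y e)).
Proof.
have [n] := ubnP (nd Y); elim: n Y => // n IHn Y nY dY.
have [|w hw] := hn_vge_of_lt dY.
  by move=> Z dZ ZY; apply: IHn => //; exact: leq_trans ZY _.
have [v Qv] := vge_exists (of_lser (Q Y)); exists (Num.min v w) => e.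
have {}hw b : b != [:: (Y, e)] -> vge (Num.min v w) (hn (Y, e) b).
  by move=> nb; apply: vge_le (hw e b nb); rewrite ge_min lexx orbT.
have {}Qv : vge (Num.min v w) (of_lser (Q Y)) by apply: vge_le Qv; rewrite ge_min lexx.
rewrite -(@hn1 (Y, e)) //.
have [s [us hs gs]] := hQ e dY (Num.min v w).
have [bs|/hs//] := boolP ([:: (Y, e)] \in s).
rewrite (bigD1_seq _ bs us) /= in gs.
have hr : vge (Num.min v w) (\sum_(b <- s | b != [:: (Y, e)]) hn (Y, e) b).
  by apply: vge_sum => b _; exact: hw.
have := vgeB (vgeB Qv gs) hr; congr vge; ring.
Qed.

Lemma hn_vge Y : isd Y -> exists w, forall e b, vge w (hn (Y, e) b).
Proof.
move=> dY; have [|w hw] := hn_vge_of_lt dY; first by move=> Z dZ _; exact: Qd_vge.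
have [v hv] := Qd_vge dY; exists (Num.min v w) => e b.
have [->|nb] := eqVneq b [:: (Y, e)].
  by rewrite hn1 //; apply: vge_le (hv e); rewrite ge_min lexx.
by apply: vge_le (hw e b nb); rewrite ge_min lexx orbT.
Qed.

End Bounds.

(** * Substitution of the recursion into itself *)

Section Substitution.
Variables (Qd : data -> int -> lser) (X : data) (d : int) (dX : isd X).
Notation lam := ((d%:~R + alphad X) / (nd X)%:R).

(** The coefficient of the product of the Q_(R_k) contributed by one degree vector, before the
    geometric series are summed. *)
Definition cterm (c : seq item) : laurent :=
  if [&& is_partition m P0 X (map fst c), \sum_(p <- c) p.2 == d & cone lam 0 c]
  then (-1) ^+ (size c).-1 * xm (pairsum npair c) else 0.

(** The general term of the double sum obtained by substitution. The outer index is recovered from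
    the inner ones by merging, so [jj] alone indexes it. *)
Definition bterm (jj : seq (seq item)) : laurent :=
  let c := map merge jj in cterm c * lprodf (map (hn Qd) c) jj.

Lemma hn_merge b : alldata b -> hn Qd (merge b) b =
  if (b != [::]) && decreasing b then hnterm Qd b else 0.
Proof.
move=> db; rewrite hnE eqxx andbT; case: (eqVneq b [::]) => [->//|b0].
rewrite is_partitionE ?is_data_merge // alldata_map db eqxx.
by case: b b0 {db}.
Qed.

Lemma hn_merge_eq0 b : ~~ alldata b -> hn Qd (merge b) b = 0.
Proof. by move=> ndb; rewrite hnE /is_partition alldata_map (negPf ndb) andbF. Qed.

Lemma lprodf_merge jj : all (fun b => b != [::]) jj ->
  lprodf (map (hn Qd) (map merge jj)) jj =
  if all alldata jj && all decreasing jj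
  then xm (\sum_(b <- jj) pairsum npair b) * \prod_(p <- flatten jj) of_lser (Qd p.1 p.2)
  else 0.
Proof.
elim: jj => [|b jj IHjj] /=; first by rewrite !big_nil xm0 mul1r.
case/andP => b0 jj0; rewrite IHjj // big_cons big_cat xmD.
have [db|ndb] := boolP (alldata b); last by rewrite hn_merge_eq0 // mul0r.
rewrite hn_merge // b0 /=; case: (decreasing b); last by rewrite /= andbF mul0r.
rewrite /=; case: ifP => _; last by rewrite mulr0.
by rewrite /hnterm mulrACA.
Qed.

Lemma sum_snd_merge jj : \sum_(p <- map merge jj) p.2 = \sum_(p <- flatten jj) p.2.
Proof. by rewrite big_flatten big_map. Qed.

Lemma alldata_flatten jj : alldata (flatten jj) = all alldata jj.
Proof. by elim: jj => //= b jj IHjj; rewrite /alldata all_cat -IHjj. Qed.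

Lemma is_partition_merge jj : all (fun b => b != [::]) jj -> all alldata jj ->
  is_partition m P0 X (map fst (map merge jj)) = is_partition m P0 X (map fst (flatten jj)).
Proof.
move=> jj0 djj; rewrite !is_partitionE // !alldata_map alldata_flatten djj.
have -> : alldata (map merge jj).
  by rewrite /alldata all_map; apply/allP => b bjj; apply: is_data_merge;
    [exact: (allP jj0)|exact: (allP djj)].
rewrite map_flatten cdata_flatten -!map_comp; congr (_ && _).
by case: jj jj0 {djj} => [|[|p b] jj].
Qed.

(** The position of the cuts enters only through the integer [bweight]: by additivity of N, the
    monomial depends on the flattened sequence alone. *)
Lemma bterm_flatten jj : all (fun b => b != [::]) jj ->
  bterm jj = if is_partition m P0 X (map fst (flatten jj)) && (\sum_(p <- flatten jj) p.2 == d)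
             then (bweight lam 0 jj)%:~R * hnterm Qd (flatten jj) else 0.
Proof.
move=> jj0; rewrite /bterm lprodf_merge //.
have [djj|ndjj] := boolP (all alldata jj); last first.
  by rewrite mulr0 /is_partition alldata_map alldata_flatten (negPf ndjj) andbF.
rewrite /cterm is_partition_merge // sum_snd_merge /bweight !andbA /=.
case: (is_partition _ _ _ _ && _) => /=; last by rewrite mul0r.
case: (all decreasing jj) => /=; last by rewrite mulr0 mul0r.
case: (cone _ _ _); last by rewrite !mul0r.
rewrite /hnterm pairsum_merge // xmD size_map rmorphXn /= rmorphN1.
by rewrite !mulrA.
Qed.

Lemma bterm_eq0 jj : ~~ all (fun b => b != [::]) jj -> bterm jj = 0.
Proof.
rewrite -has_predC => /hasP[b bjj /negPn/eqP b0]; rewrite /bterm.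
have -> : lprodf (map (hn Qd) (map merge jj)) jj = 0; last by rewrite mulr0.
elim: jj bjj => //= b' jj IHjj; rewrite inE => /orP[/eqP<-|/IHjj->]; last by rewrite mulr0.
by rewrite b0 hn_merge ?mul0r.
Qed.

Lemma sum_bterm_blockings j : \sum_(jj <- blockings j) bterm jj =
  if is_partition m P0 X (map fst j) && (\sum_(p <- j) p.2 == d)
  then (\sum_(jj <- blockings j) bweight lam 0 jj)%:~R * hnterm Qd j else 0.
Proof.
rewrite (eq_big_seq (fun jj =>
   if is_partition m P0 X (map fst j) && (\sum_(p <- j) p.2 == d)
             then (bweight lam 0 jj)%:~R * hnterm Qd j else 0)).
  by case: ifP => _; [rewrite rmorph_sum mulr_suml | rewrite big1].
by move=> jj; rewrite mem_blockings => /andP[/eqP <- jj0]; exact: bterm_flatten.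
Qed.

Lemma sum_excess j : is_partition m P0 X (map fst j) -> \sum_(p <- j) p.2 == d ->
  \sum_(p <- j) excess lam p = 0.
Proof.
rewrite is_partitionE // alldata_map => /and3P[_ dj /eqP eX] /eqP ed.
have := excess_merge lam dj; rewrite /excess /= -eX ed => <-.
by rewrite divfK ?subrr // pnatr_eq0 -lt0n nd_gt0.
Qed.

Lemma sum_bterm_eq j : \sum_(jj <- blockings j) bterm jj =
  if j == [:: (X, d)] then of_lser (Qd X d) else 0.
Proof.
rewrite sum_bterm_blockings; case: ifP => [/andP[pj sj]|].
  have := pj; rewrite is_partitionE // alldata_map => /and3P[j0 dj /eqP eX].
  case: j j0 dj pj sj eX => [|p [|q j]] // _ dj pj sj.
    rewrite /= in dj; rewrite andbT in dj; rewrite /= cdata1 // => eX.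
    have -> : [:: p] == [:: (X, d)].
      by move: sj; rewrite big_seq1 => /eqP <-; rewrite eX -surjective_pairing.
    rewrite big_seq1 /bweight /= mul1r hnterm1 -eX.
    by move: sj; rewrite big_seq1 => /eqP ->.
  by rewrite sum_bweight_eq0 ?sum_excess // mul0r eqseq_cons andbF.
case: (eqVneq j [:: (X, d)]) => // ->; rewrite is_partitionE //= dX cdata1 // eqxx big_seq1.
by rewrite eqxx.
Qed.

Lemma sums_to_flatten_fibre j :
  sums_to (fun jj => if flatten jj == j then bterm jj else 0)
          (if j == [:: (X, d)] then of_lser (Qd X d) else 0).
Proof.
rewrite -sum_bterm_eq.
rewrite (eq_big_seq (fun jj => if flatten jj == j then bterm jj else 0)); last first.
  by move=> jj; rewrite mem_blockings => /andP[-> _].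
apply: sums_to_finite; first exact: uniq_blockings.
move=> jj; rewrite mem_blockings; case: eqP => //= _.
exact: bterm_eq0.
Qed.

Lemma hn_neq0 p b : isd p.1 -> hn Qd p b != 0 -> merge b = p.
Proof.
case: p => Y e /= dY; rewrite hnE /= is_partitionE //.
case: ifP => [/andP[/andP[/and3P[_ _ /eqP->] /eqP<-] _ _]|_]; last by rewrite eqxx. by [].
Qed.

Lemma lprodf_neq0 c jj : alldata c -> lprodf (map (hn Qd) c) jj != 0 -> map merge jj = c.
Proof.
elim: c jj => [|p c IHc] [|b jj] //=; rewrite ?eqxx //.
case/andP => dp dc h; rewrite (@hn_neq0 p b) ?IHc //.
  by apply: contraNneq h => ->; rewrite mulr0.
by apply: contraNneq h => ->; rewrite mul0r.
Qed.

Lemma alldata_cterm c : cterm c != 0 -> alldata c.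
Proof.
rewrite /cterm; case: ifP; rewrite ?eqxx // => /and3P[pc _ _] _.
by move: pc; rewrite is_partitionE // => /and3P[_]; rewrite alldata_map.
Qed.

Variable Q : data -> lser.
Hypothesis hQ : forall (X : data) (d : int), isd X ->
  sums_to (hn Qd (X, d)) (of_lser (Q X)).

(** This is the product of the recursions for the parts of [c], multiplied out. Restricting to the
    fibre costs nothing, as a nonzero product forces the blocks to merge to [c]. *)
Lemma sums_to_merge_fibre c :
  sums_to (fun jj => if map merge jj == c then bterm jj else 0)
          (cterm c * \prod_(p <- c) of_lser (Q p.1)).
Proof.
have [c0|c0] := eqVneq (cterm c) 0.
  rewrite c0 mul0r; apply: (sums_to_ext (F := fun=> 0)).
    by move=> jj; case: eqP => // e; rewrite /bterm e c0 mul0r.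
  by have := @sums_to_finite _ (fun _ : seq (seq item) => 0) [::]; rewrite big_nil; apply.
have dc := alldata_cterm c0.
have h : sums_to (lprodf (map (hn Qd) c)) (\prod_(p <- c) of_lser (Q p.1)).
  by apply: sums_to_lprodf => -[Y e] pc; apply: hQ; exact: (allP dc _ pc).
rewrite mulrC; apply: sums_to_ext (sums_to_scale (cterm c) h) => jj /=.
case: eqP => [e|ne]; first by rewrite /bterm e mulrC.
have [->|nz] := eqVneq (lprodf (map (hn Qd) c) jj) 0; first by rewrite mul0r.
by case: ne; exact: lprodf_neq0.
Qed.

End Substitution.

(** * The geometric sum over the cone *)

(** Summation by parts: the degree part of N becomes linear in the proper partial sums, with the
    total degree entering only a constant. *)
Lemma abel_summation (n e : nat -> int) r :
  \sum_(l < r.+1) \sum_(k < r.+1 | (l < k)%N) (e l * n k - e k * n l) =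
  \sum_(k < r) (n k + n k.+1) * (\sum_(i < k.+1) e i)
    - (\sum_(k < r) n k) * (\sum_(k < r.+1) e k).
Proof.
elim: r => [|r IHr].
  by rewrite big_ord1 big1 ?big_ord0 ?mul0r ?subr0 // => k; case: k => -[].
rewrite big_ord_recr /= [X in _ + X]big1 ?addr0 => [|k]; last by have := ltn_ord k; lia.
transitivity (\sum_(l < r.+1) (\sum_(k < r.+1 | (l < k)%N) (e l * n k - e k * n l)
                              + (e l * n r.+1 - e r.+1 * n l))).
  apply: eq_bigr => l _; rewrite big_mkcond big_ord_recr /= ltn_ord.
  by rewrite -big_mkcond.
rewrite big_split IHr /= sumrB -mulr_suml -mulr_sumr.
rewrite [\sum_(k < r.+1) (n k + n k.+1) * _]big_ord_recr /=.
rewrite [\sum_(k < r.+2) e k]big_ord_recr /= [\sum_(k < r.+1) n k]big_ord_recr /=.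
by ring.
Qed.

Lemma sum_adjacent (n : nat -> int) r :
  \sum_(k < r) (n k + n k.+1) = 2 * (\sum_(k < r.+1) n k) - n 0%N - n r.
Proof.
elim: r => [|r IHr]; first by rewrite big_ord0 big_ord1; ring.
by rewrite big_ord_recr /= IHr [\sum_(k < r.+2) _]big_ord_recr /=; ring.
Qed.

(** The last partial sum is omitted because it is the fixed total degree. Degree vectors of given
    total thus correspond to unconstrained integer vectors one shorter, with inverse
    [increments]. *)
Fixpoint psums (a : int) (es : seq int) : seq int :=
  if es is e :: es' then if es' is [::] then [::] else (a + e) :: psums (a + e) es' else [::].

Fixpoint increments (a d : int) (Ds : seq int) : seq int :=
  if Ds is D :: Ds' then (D - a) :: increments D d Ds' else [:: d - a].

Lemma size_increments a d Ds : size (increments a d Ds) = (size Ds).+1.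
Proof. by elim: Ds a => //= D Ds IH a; rewrite IH. Qed.

Lemma size_psums a es : size (psums a es) = (size es).-1.
Proof. by elim: es a => // e [|e' es] IH a //=; rewrite IH. Qed.

Lemma incrementsK a d Ds : psums a (increments a d Ds) = Ds.
Proof.
elim: Ds a => //= D Ds IH a; rewrite addrC subrK IH.
by case: Ds {IH}.
Qed.

Lemma sum_increments a d Ds : \sum_(e <- increments a d Ds) e = d - a.
Proof.
elim: Ds a => [|D Ds IH] a /=; first by rewrite big_seq1.
by rewrite big_cons IH addrC addrA subrK.
Qed.

Lemma psumsK a es : es != [::] -> increments a (a + \sum_(e <- es) e) (psums a es) = es.
Proof.
elim: es a => // e [|e' es] IH a _.
  by rewrite /= big_seq1 addrC addKr.
rewrite big_cons addrA.
rewrite -[LHS]/((a + e - a) :: increments (a + e) _ (psums (a + e) (e' :: es))).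
by rewrite IH // addrC addKr.
Qed.

Lemma nth_psums a es k : (k < (size es).-1)%N ->
  nth 0 (psums a es) k = a + \sum_(i < k.+1) nth 0 es i.
Proof.
elim: es a k => [|e [|e' es] IH] a [|k] // kes.
  by rewrite big_ord1.
rewrite big_ord_recl /= addrA; exact: (IH (a + e) k).
Qed.

Lemma lprodf_iota (Fs : nat -> int -> laurent) r js : size js = r ->
  lprodf (map Fs (iota 0 r)) js = \prod_(k < r) Fs k (nth 0 js k).
Proof.
rewrite -[iota 0 r]/(iota (0 + 0) r) => <-.
suff H a : lprodf (map Fs (iota a (size js))) js = \prod_(k < size js) Fs (a + k)%N (nth 0 js k).
  exact: H 0%N.
elim: js a => [|j js IH] a /=; first by rewrite big_ord0.
rewrite big_ord_recl addn0 IH; congr (_ * _); apply: eq_bigr => k _.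
by rewrite addSnnS.
Qed.

Lemma cone_nth lam h c : cone lam h c =
  [forall k : 'I_(size c).-1, 0 < h + \sum_(i < k.+1) excess lam (nth (data0 S, 0) c i)].
Proof.
elim: c h => [|p [|p' c] IHc] h; try by apply/esym/forallP => -[].
rewrite [LHS]/= -/(cone lam _ (p' :: c)) IHc /=.
apply/andP/forallP => [[hp /forallP h'] [[|k] ik]|H].
- by rewrite big_ord1.
- have := h' (Ordinal (ik : (k < size c)%N)).
  by rewrite /= [X in _ -> 0 < h + X]big_ord_recl (addrA h (excess _ _)).
- split; first by have := H ord0; rewrite big_ord1.
  apply/forallP => k; have := H (lift ord0 k).
  by rewrite big_ord_recl (addrA h (excess _ _)).
Qed.

Section Geometric.
Variables (X : data) (d : int) (dX : isd X) (ps : seq data).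
Hypothesis hps : is_partition m P0 X ps.
Notation lam := ((d%:~R + alphad X) / (nd X)%:R).
Notation r := (size ps).-1.
Let n k := nd (part ps k).
Let a k := (n k + n k.+1)%N.
Let fl k := Num.floor ((nd_le P0 ps k)%:R * lam - alpha_le alpha ps k).
Let e0 := - ((nd X)%:Z - (n r)%:Z) * d - (sigmaI m ps)%:Z.
Let Fam k (D : int) := if fl k < D then - xm ((a k)%:Z * D) else 0.

Let size_ps : size ps = r.+1.
Proof. by have := hps; rewrite is_partitionE //; case: (ps). Qed.

Let data_part k : (k < size ps)%N -> isd (part ps k).
Proof.
by have := hps; rewrite is_partitionE // => /and3P[_ /all_nthP dps _]; exact: dps.
Qed.

Let sum_n : (nd X)%:Z = \sum_(k < r.+1) (n k)%:Z.
Proof.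
rewrite (nd_partition dX hps) (big_nth (data0 S)) big_mkord size_ps.
exact: (big_morph Posz PoszD).
Qed.

Definition geometric_factor : laurent :=
  xm (MpRI m P0 X ps d + MRI alpha P0 ps lam) *
  \prod_(k <- iota 0 r) of_lser (linv_xa_m1 (nd (part ps k) + nd (part ps k.+1))).

(** The extra 1 beside each floor contributes the sum of the n_k + n_(k+1), which is 2n(R) - n(R_1)
    - n(R_r); this separates the exponent into one monomial per series and the constant [e0]. *)
Lemma geometric_factorE : geometric_factor =
  (\prod_(k <- iota 0 r) (xm ((a k)%:Z * (fl k + 1)) * of_lser (linv_xa_m1 (a k)))) * xm e0.
Proof.
rewrite big_split /= mulrAC -[\prod_(k <- _) xm _]xm_sum -xmD; congr (xm _ * _).
have iota_sum (F : nat -> int) : \sum_(k <- iota 0 r) F k = \sum_(k < r) F k.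
  by rewrite -(big_mkord xpredT) /index_iota subn0.
have -> : \sum_(k <- iota 0 r) (a k)%:Z * (fl k + 1) =
    MRI alpha P0 ps lam + (2 * (nd X)%:Z - (n 0)%:Z - (n r)%:Z).
  rewrite iota_sum sum_n -(@sum_adjacent (fun k => (n k)%:Z)) -big_split /=.
  by apply: eq_bigr => k _; rewrite mulrDr mulr1 PoszD.
rewrite /MpRI /e0 /n; ring.
Qed.

(** In terms of partial sums the cone becomes a product of half-lines and the exponent a sum, so the
    term factors. *)
Lemma cterm_psums c : map fst c = ps -> \sum_(p <- c) p.2 = d ->
  cterm X d c = lprodf (map Fam (iota 0 r)) (psums 0 (map snd c)) * xm e0.
Proof.
move=> cps cd.
have size_c : size c = r.+1 by rewrite -(size_map fst) cps size_ps.
pose D k := \sum_(i < k.+1) nth 0 (map snd c) i.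
have nth_fst i : (i < size c)%N -> (nth (data0 S, 0) c i).1 = part ps i.
  by move=> ic; rewrite /part -cps (nth_map (data0 S, 0)).
have nth_snd i : (i < size c)%N -> (nth (data0 S, 0) c i).2 = nth 0 (map snd c) i.
  by move=> ic; rewrite (nth_map (data0 S, 0)).
have coneE (k : 'I_r) :
    (0 < 0 + \sum_(i < k.+1) excess lam (nth (data0 S, 0) c i)) = (fl k < D k).
  (* Since [D k] is an integer, exceeding a real number is the same as exceeding its floor. *)
  rewrite add0r floor_lt_int ltrBlDr -subr_gt0; congr (0 < _).
  rewrite /nd_le /alpha_le /D natr_sum rmorph_sum /= mulr_suml -big_split -sumrB /=.
  apply: eq_bigr => i _; rewrite /excess.
  have ic : (i < size c)%N by rewrite size_c; have := ltn_ord i; have := ltn_ord k; lia.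
  by rewrite nth_fst // nth_snd // [lam * _]mulrC.
rewrite lprodf_iota ?size_psums ?size_map ?size_c //.
have -> : \prod_(k < r) Fam k (nth 0 (psums 0 (map snd c)) k) = \prod_(k < r) Fam k (D k).
  by apply: eq_bigr => k _; rewrite nth_psums ?add0r // size_map size_c.
rewrite /cterm cps hps cd eqxx cone_nth /= size_c /=.
case: forallP => [h|h]; last first.
  have /existsP[k nk] : [exists k : 'I_r, ~~ (fl k < D k)].
    rewrite -negb_forall; apply/negP => /forallP h'; apply: h => k.
    by rewrite coneE.
  by rewrite (bigD1 k) //= /Fam (negPf nk) !mul0r.
have -> : \prod_(k < r) Fam k (D k) = \prod_(k < r) - xm ((a k)%:Z * D k).
  by apply: eq_bigr => k _; rewrite /Fam -coneE h.
rewrite prodrN -[\prod_(k < r) xm _]xm_sum card_ord -mulrA -xmD; congr (_ * xm _).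
rewrite -NRI_pairsum /NRI cps size_ps.
rewrite (@abel_summation (fun k => (n k)%:Z) (fun k => nth 0 (map snd c) k)).
have -> : \sum_(k < r.+1) nth 0 (map snd c) k = d.
  by rewrite -cd -[RHS](big_map snd xpredT id) [RHS](big_nth 0) big_mkord size_map size_c.
rewrite /e0 sum_n big_ord_recr /= addrK mulNr addrA; congr (_ - _ - _).
Qed.

Lemma sums_to_geometric_fibre :
  sums_to (fun c => if map fst c == ps then cterm X d c else 0) geometric_factor.
Proof.
rewrite geometric_factorE.
have h : sums_to (lprodf (map Fam (iota 0 r)))
    (\prod_(k <- iota 0 r) (xm ((a k)%:Z * (fl k + 1)) * of_lser (linv_xa_m1 (a k)))).
  apply: sums_to_lprodf => k; rewrite mem_iota add0n /= => kr.
  apply: geometric_int; rewrite /a addn_gt0 /n nd_gt0 ?data_part //.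
  by rewrite size_ps ltnS ltnW.
(* Lists of the wrong length contribute 0, so the reindexing map only matters on lists of length
   [r], where zipping with [ps] loses nothing. *)
have sz Ds : lprodf (map Fam (iota 0 r)) Ds * xm e0 != 0 -> size Ds = r.
  move=> nz; have {nz}: lprodf (map Fam (iota 0 r)) Ds != 0.
    by apply: contraNneq nz => ->; rewrite mul0r.
  rewrite -[RHS](size_iota 0 r); elim: (iota 0 r) Ds => [|k s IHs] [|D Ds] //=; rewrite ?eqxx //.
  by move=> nz; rewrite IHs //; apply: contraNneq nz => ->; rewrite mulr0.
pose f Ds : seq item := zip ps (increments 0 d Ds).
have fst_f Ds : size Ds = r -> map fst (f Ds) = ps.
  by move=> sD; rewrite [map _ _]unzip1_zip // size_increments sD size_ps.
have snd_f Ds : size Ds = r -> map snd (f Ds) = increments 0 d Ds.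
  by move=> sD; rewrite [map _ _]unzip2_zip // size_increments sD size_ps.
have sum_snd (c : seq item) : \sum_(p <- c) p.2 = \sum_(x <- map snd c) x by rewrite big_map.
apply: (sums_to_reindex (f := f)) (sums_to_scale (xm e0) h).
- move=> Ds Ds' /sz sD /sz sD' ef.
  by rewrite -(incrementsK 0 d Ds) -(incrementsK 0 d Ds') -!snd_f // ef.
- move=> Ds /sz sD; rewrite fst_f // eqxx cterm_psums ?fst_f //.
    by rewrite snd_f // incrementsK.
  by rewrite sum_snd snd_f // sum_increments subr0.
- move=> c; case: (map fst c =P ps) => [cps|_]; last by rewrite eqxx.
  move=> nz; have cd : \sum_(p <- c) p.2 = d.
    by apply/eqP; apply: contraNT nz => /negPf cd; rewrite /cterm cd andbF.
  exists (psums 0 (map snd c)); last by rewrite -cterm_psums.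
  have := @psumsK 0 (map snd c); rewrite add0r -sum_snd cd /f => ->; last first.
    by rewrite -size_eq0 size_map -(size_map fst) cps size_ps.
  by rewrite -cps; exact: zip_unzip.
Qed.

End Geometric.

(** * Exchange of the two summations *)

Section Inversion.
Variables (Qd : data -> int -> lser) (Q : data -> lser).
Hypothesis hQ : forall (X : data) (d : int), isd X ->
  sums_to (hn Qd (X, d)) (of_lser (Q X)).
Variables (X : data) (d : int) (dX : isd X).

(** There are finitely many partitions. For each, the inner factors are bounded uniformly in the
    degrees, while the cone terms tend to 0, so only finitely many merged sequences matter at a
    given precision. *)
Lemma summable_bterm : summable (bterm Qd X d).
Proof.
apply: (summable_fibres (sums_to_merge_fibre d dX hQ)) => N.
have [PL hPL] := partitions_finite dX.
have /choice[t ht] ps : exists t : seq (seq item), is_partition m P0 X ps ->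
    forall jj, map fst (map merge jj) = ps -> map merge jj \notin t -> vge N (bterm Qd X d jj).
  have [hps|_] := boolP (is_partition m P0 X ps); last by exists [::].
  have := hps; rewrite is_partitionE // => /and3P[_ /allP dps _].
  have [||W hW] := @exists_uniform_bound _ ps (fun Y w => forall e b, vge w (hn Qd (Y, e) b)).
  - by move=> Y a b le_ab h e c; exact: vge_le (h e c).
  - by move=> Y /dps dY; exact: (hn_vge hQ dY).
  (* The precision is shifted by the bound [W] for each of the inner factors. *)
  have [t [_ ht _]] := sums_to_geometric_fibre d dX hps (N - W *+ size ps).
  exists t => _ jj eps /ht; rewrite eps eqxx => hc.
  rewrite /bterm -[N](subrK (W *+ size ps)); apply: vgeM => //.
  have -> : size ps = size (map merge jj) by rewrite -eps size_map.
  apply: vge_lprodf => -[Y e] b Yjj; apply: hW.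
  by rewrite -eps; apply/mapP; exists (Y, e).
exists (flatten (map t PL)) => jj nt.
have [hps|nps] := boolP (is_partition m P0 X (map fst (map merge jj))); last first.
  by rewrite /bterm /cterm (negPf nps) /= mul0r; exact: vge0.
apply: (ht _ hps _ erefl); apply: contra nt => nt.
apply/flattenP; exists (t (map fst (map merge jj))) => //.
by apply: map_f; exact: hPL.
Qed.

(** The double sum is grouped by the flattened sequence, where all fibres but one cancel. *)
Lemma sums_to_bterm : sums_to (bterm Qd X d) (of_lser (Qd X d)).
Proof.
apply: (sums_to_of_fibres (sums_to_flatten_fibre Qd d dX) summable_bterm).
have := @sums_to_finite _
  (fun j => if j == [:: (X, d)] then of_lser (Qd X d) else 0) [:: [:: (X, d)]] isT.
by rewrite big_seq1 eqxx; apply => j; rewrite inE => /negPf->.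
Qed.

Lemma sums_to_conc_fibre ps :
  sums_to (fun c => if map fst c == ps
                    then cterm X d c * \prod_(p <- c) of_lser (Q p.1) else 0)
          (of_lser (conc_term m alpha P0 Q X d ps)).
Proof.
rewrite /conc_term; case: ifP => hps.
  rewrite !of_lser_mul of_lser_prod of_lser_prod [X in sums_to _ X]lmultA.
  apply: sums_to_ext (sums_to_scale (\prod_(Y <- ps) of_lser (Q Y))
    (sums_to_geometric_fibre d dX hps)) => c.
  case: eqP => [<-|_]; last by rewrite mul0r.
  by rewrite big_map.
apply: (sums_to_ext (F := fun=> 0)) => [c|].
  by case: eqP => // e; rewrite /cterm e hps mul0r.
by have := @sums_to_finite _ (fun _ : seq item => 0) [::]; rewrite big_nil; apply.
Qed.

(** The same double sum is grouped by merged sequences, which resums the recursions, and then by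
    partitions, which sums the geometric series. *)
Lemma sums_to_conc :
  sums_to (fun ps => of_lser (conc_term m alpha P0 Q X d ps)) (of_lser (Qd X d)).
Proof.
apply: (sums_to_fibres sums_to_conc_fibre).
exact: (sums_to_fibres (sums_to_merge_fibre d dX hQ) sums_to_bterm).
Qed.

End Inversion.

End Data.

Theorem theorem5p2 (S : finType) (P0 : S) (m : S -> nat) (rR : realType)
    (alpha : S -> nat -> rR)
    (hm : forall P, (0 < m P)%N)
    (ha0 : forall P, 0 <= alpha P 0%N)
    (hainc : forall P (i : nat), (i.+1 < m P)%N -> alpha P i < alpha P i.+1)
    (ha1 : forall P, alpha P (m P).-1 < 1)
    (Qd : dataT S -> int -> lser) (Q : dataT S -> lser)
    (hQ : forall (X : dataT S) (d : int), is_data m P0 X ->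
            lhas_sum (hyp_term m alpha P0 Qd X d) (Q X)) :
  forall (X : dataT S) (d : int), is_data m P0 X ->
    lhas_sum (conc_term m alpha P0 Q X d) (Qd X d).
Proof.
move=> X d dX; apply/lhas_sum_of/sums_to_conc => // Y e dY.
exact: sums_to_of_lser (hQ Y e dY).
Qed.
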